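(* Let $\lambda$ be a Cremer number. Then there exists a skew-product of the form $$F(z,w)=(\lambda z,\ w+a(z)+w^2),$$ with $a(z)$ holomorphic (in a neighborhood of $0\in\mathbb C$) and satisfying $a(0)=0$, such that $F$ does not admit a holomorphic invariant curve of the form $\{w=\varphi(z)\}$; that is, there is no function $\varphi$ holomorphic in a neighborhood of $0$ satisfying $\varphi(z)+a(z)+\varphi(z)^2=\varphi(\lambda z)$ for all $z$ near $0$.
   Context: A complex number $\lambda=e^{2\pi i\theta}$ with $\theta\in\mathbb R\setminus\mathbb Q$ is called Cremer if $$\limsup_{m\to\infty}\frac1m\log\frac1{\omega(m)}=+\infty,\qquad \omega(m)=\min_{2\le k\le m}|\lambda^k-\lambda|.$$ *)

(* Defs.v *)
From Stdlib Require Import QArith Qreals Reals RList List.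
From Coquelicot Require Import Coquelicot.
Open Scope R_scope.

Definition irrational (theta : R) : Prop := forall q : Q, theta <> Q2R q.

(* Coquelicot has no complex exponential; this is e^{it} for real [t]. *)
Definition cis (t : R) : C := (cos t, sin t).

(* The minimum of [|lambda^k - lambda|] over [2 <= k <= m].  For [m < 2] the
   list is empty and the value is the junk constant [MinRlist nil = 1], which
   does not affect the upper limit below. *)
Definition omega (lambda : C) (m : nat) : R :=
  MinRlist (map (fun k => Cmod (lambda ^ k - lambda)%C) (seq 2 (m - 1))).

Definition Cremer (lambda : C) : Prop :=
  (exists theta : R, irrational theta /\ lambda = cis (2 * PI * theta)) /\
  LimSup_seq (fun m => 1 / INR m * ln (1 / omega lambda m)) = p_infty.

(* Complex differentiability at every point of some neighbourhood of 0.  The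
   base ring is given explicitly so that the derivative is the complex one,
   not the real one on [R * R]. *)
Definition holomorphic_near_0 (f : C -> C) : Prop :=
  locally (RtoC 0) (fun z => @ex_derive C_AbsRing C_NormedModule f z).

Definition skew_product (lambda : C) (a : C -> C) (p : C * C) : C * C :=
  let (z, w) := p in ((lambda * z)%C, (w + a z + w ^ 2)%C).

(* [F] sends the point [(z, phi z)] of the graph [{w = phi(z)}] to a point of
   the same graph, for all [z] near 0. *)
Definition invariant_curve (F : C * C -> C * C) (phi : C -> C) : Prop :=
  locally (RtoC 0)
    (fun z => snd (F (z, phi z)) = phi (fst (F (z, phi z)))).

Lemma invariant_curve_skew_product (lambda : C) (a phi : C -> C) :
  invariant_curve (skew_product lambda a) phi <->
  locally (RtoC 0)
    (fun z => (phi z + a z + phi z ^ 2)%C = phi (lambda * z)%C).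
Proof. reflexivity. Qed.

(* Main.v *)
Require Import Defs.
From Stdlib Require Import QArith Qreals Reals RList List Lra Lia.
From Stdlib Require Import Classical ClassicalEpsilon FunctionalExtensionality.
From Coquelicot Require Import Coquelicot.
Open Scope R_scope.

(** Why the statement holds.  Comparing Taylor coefficients at 0 in the
    functional equation of an invariant curve gives, for [n >= 1],

      [(lambda^n - 1) c_n = a_n + conv c c n],

    where [c_0 = 0] is forced and the convolution then involves only
    [c_1, ..., c_{n-1}].  Hence [a] determines [c], and [a_n] may be chosen
    after [c_1, ..., c_{n-1}]: taking [a_n] to be 0 or 1 so that the right-hand
    side has modulus at least 1/2 gives [|c_n| >= 1 / (2 |lambda^n - 1|)]
    ([formal_solution]).  Since [a] has bounded coefficients it is holomorphic in
    the unit disc, whereas the Cremer condition makes infinitely many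
    [|lambda^n - 1|] smaller than any geometric sequence ([Cremer_divisors]), so
    [c_n] cannot be the Taylor coefficients of a holomorphic [phi].

    The analytic input is thus that a function differentiable near 0 has Taylor
    coefficients of at most geometric growth, in a form strong enough to compare
    coefficients ([holomorphic_expands]).  Coefficients are compared through
    asymptotic expansions, [|f z - sum_{n<N} c_n z^n| <= K |z|^N] for every [N]:
    these are unique, add up, and multiply by convolution.

    The expansions come from Cauchy's formula on a square [Q] around 0.  Goursat's
    lemma ([goursat]), extended to allow one point where the function is only
    bounded ([goursat_removable]) and applied to the difference quotient of [f] at
    [w], gives [f w * T 1 w = T f w], where [T f w] is the integral of
    [f z / (z - w)] over the boundary of [Q] ([cauchy_square]).  The identity
    [1 / (z - w) = 1 / z + w / (z (z - w))] turns [T f] into an expansion whose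
    [n]-th coefficient is the integral of [f z / z^(n+1)], which is bounded
    geometrically.  For [f = 1] every coefficient with [n >= 1] vanishes because
    [z^(-n-1)] has a primitive, and the zeroth one, [L], is not zero
    ([cauchy_coef_one_0]).  So [T f w = L f w] up to every order, and dividing by
    [L] expands [f]. *)

(** * Complex differentiability *)

Definition ccont (f : C -> C) (z : C) : Prop :=
  forall eps, 0 < eps -> exists delta, 0 < delta /\
    forall w, Cmod (w - z) < delta -> Cmod (f w - f z) <= eps.

(** The complex derivative with explicit error terms, the form in which the
    local estimates of Goursat's lemma and of Cauchy's formula use it. *)
Definition cderiv (f : C -> C) (z d : C) : Prop :=
  forall eps, 0 < eps -> exists delta, 0 < delta /\
    forall w, Cmod (w - z) < delta ->
      Cmod (f w - f z - d * (w - z)) <= eps * Cmod (w - z).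

Lemma Cmod_triangle_minus (x y : C) : Cmod (x - y) <= Cmod x + Cmod y.
Proof. unfold Cminus. rewrite <- (Cmod_opp y). apply Cmod_triangle. Qed.

Lemma Cmod_triangle_le (x y : C) (a b : R) :
  Cmod x <= a -> Cmod y <= b -> Cmod (x + y) <= a + b.
Proof. intros; pose proof (Cmod_triangle x y); lra. Qed.

Lemma Cmod_minus_ge (x y : C) : Cmod x - Cmod y <= Cmod (x - y).
Proof.
  pose proof (Cmod_triangle (x - y) y) as H.
  replace (x - y + y)%C with x in H by ring. lra.
Qed.

Lemma Cmod_minus_sym (x y : C) : Cmod (x - y) = Cmod (y - x).
Proof. rewrite <- Cmod_opp. f_equal. ring. Qed.

Lemma Cmod_mult_le (x y : C) (a b : R) :
  Cmod x <= a -> Cmod y <= b -> Cmod (x * y) <= a * b.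
Proof.
  intros. rewrite Cmod_mult.
  apply Rmult_le_compat; auto using Cmod_ge_0.
Qed.

Lemma Cmod_le_abs (z : C) : Cmod z <= Rabs (fst z) + Rabs (snd z).
Proof.
  destruct z as [x y]; simpl.
  unfold Cmod. simpl. rewrite !Rmult_1_r.
  rewrite <- (sqrt_Rsqr (Rabs x + Rabs y)).
  - apply sqrt_le_1_alt. unfold Rsqr.
    pose proof (Rabs_pos x). pose proof (Rabs_pos y).
    pose proof (Rsqr_abs x). pose proof (Rsqr_abs y). unfold Rsqr in *. nra.
  - pose proof (Rabs_pos x). pose proof (Rabs_pos y). lra.
Qed.

Lemma fst_le_Cmod (z : C) : Rabs (fst z) <= Cmod z.
Proof. eapply Rle_trans. apply Rmax_l. apply Rmax_Cmod. Qed.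

Lemma snd_le_Cmod (z : C) : Rabs (snd z) <= Cmod z.
Proof. eapply Rle_trans. apply Rmax_r. apply Rmax_Cmod. Qed.

Lemma cderiv_ccont f z d : cderiv f z d -> ccont f z.
Proof.
  intros H eps He. destruct (H 1 Rlt_0_1) as [d1 [Hd1 H1]].
  set (B := 1 + Cmod d). assert (0 < B) by (unfold B; pose proof (Cmod_ge_0 d); lra).
  exists (Rmin d1 (eps / B)). split.
  { apply Rmin_pos; auto. apply Rdiv_lt_0_compat; auto. }
  intros w Hw.
  pose proof (Rmin_l d1 (eps / B)). pose proof (Rmin_r d1 (eps / B)).
  specialize (H1 w ltac:(lra)).
  replace (f w - f z)%C with ((f w - f z - d * (w - z)) + d * (w - z))%C by ring.
  eapply Rle_trans. apply Cmod_triangle. rewrite Cmod_mult.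
  assert (Cmod (w - z) * B <= eps / B * B) by (apply Rmult_le_compat_r; lra).
  replace (eps / B * B) with eps in H4 by (field; lra). unfold B in H4. lra.
Qed.

Lemma cderiv_const c z : cderiv (fun _ => c) z 0.
Proof.
  intros eps He. exists 1. split; [lra|]. intros w Hw.
  replace (c - c - 0 * (w - z))%C with (RtoC 0) by ring. rewrite Cmod_0.
  pose proof (Cmod_ge_0 (w - z)). nra.
Qed.

Lemma cderiv_id z : cderiv (fun w => w) z 1.
Proof.
  intros eps He. exists 1. split; [lra|]. intros w Hw.
  replace (w - z - 1 * (w - z))%C with (RtoC 0) by ring. rewrite Cmod_0.
  pose proof (Cmod_ge_0 (w - z)). nra.
Qed.

Lemma cderiv_plus f g z df dg :
  cderiv f z df -> cderiv g z dg -> cderiv (fun w => f w + g w)%C z (df + dg).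
Proof.
  intros Hf Hg eps He.
  destruct (Hf (eps / 2) ltac:(lra)) as [d1 [Hd1 H1]].
  destruct (Hg (eps / 2) ltac:(lra)) as [d2 [Hd2 H2]].
  exists (Rmin d1 d2). split. { now apply Rmin_pos. }
  intros w Hw. pose proof (Rmin_l d1 d2). pose proof (Rmin_r d1 d2).
  specialize (H1 w ltac:(lra)). specialize (H2 w ltac:(lra)).
  replace (f w + g w - (f z + g z) - (df + dg) * (w - z))%C
    with ((f w - f z - df * (w - z)) + (g w - g z - dg * (w - z)))%C by ring.
  eapply Rle_trans. apply Cmod_triangle. lra.
Qed.

Lemma cderiv_mult f g z df dg :
  cderiv f z df -> cderiv g z dg ->
  cderiv (fun w => f w * g w)%C z (df * g z + f z * dg).
Proof.
  intros Hf Hg eps He.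
  set (B := 1 + Cmod (g z) + Cmod (f z) + Cmod df).
  assert (HB : 1 <= B) by
    (unfold B; pose proof (Cmod_ge_0 (g z)); pose proof (Cmod_ge_0 (f z));
     pose proof (Cmod_ge_0 df); lra).
  set (e := eps / (3 * B)).
  assert (He' : 0 < e) by (apply Rdiv_lt_0_compat; lra).
  assert (HeB : e * B = eps / 3) by (unfold e; field; lra).
  destruct (Hf e He') as [d1 [Hd1 H1]].
  destruct (Hg e He') as [d2 [Hd2 H2]].
  destruct (cderiv_ccont _ _ _ Hg (Rmin 1 e) ltac:(apply Rmin_pos; lra)) as [d3 [Hd3 H3]].
  exists (Rmin d1 (Rmin d2 d3)). split. { repeat apply Rmin_pos; auto. }
  intros w Hw.
  pose proof (Rmin_l d1 (Rmin d2 d3)). pose proof (Rmin_r d1 (Rmin d2 d3)).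
  pose proof (Rmin_l d2 d3). pose proof (Rmin_r d2 d3).
  pose proof (Rmin_l 1 e). pose proof (Rmin_r 1 e).
  specialize (H1 w ltac:(lra)). specialize (H2 w ltac:(lra)).
  specialize (H3 w ltac:(lra)).
  replace (f w * g w - f z * g z - (df * g z + f z * dg) * (w - z))%C
    with ((f w - f z - df * (w - z)) * g w + f z * (g w - g z - dg * (w - z))
          + df * (g w - g z) * (w - z))%C by ring.
  assert (Hgw : Cmod (g w) <= B).
  { pose proof (Cmod_minus_ge (g w) (g z)). unfold B.
    pose proof (Cmod_ge_0 (f z)). pose proof (Cmod_ge_0 df). lra. }
  assert (Hfz : Cmod (f z) <= B).
  { unfold B. pose proof (Cmod_ge_0 (g z)). pose proof (Cmod_ge_0 df). lra. }
  assert (Hdf : Cmod df <= B).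
  { unfold B. pose proof (Cmod_ge_0 (g z)). pose proof (Cmod_ge_0 (f z)). lra. }
  assert (H3' : Cmod (g w - g z) <= e) by lra.
  pose proof (Cmod_mult_le _ _ _ _ H1 Hgw) as K1.
  pose proof (Cmod_mult_le _ _ _ _ Hfz H2) as K2.
  pose proof (Cmod_mult_le _ _ _ _ (Cmod_mult_le _ _ _ _ Hdf H3') (Rle_refl (Cmod (w - z)))) as K3.
  pose proof (Cmod_triangle_le _ _ _ _ (Cmod_triangle_le _ _ _ _ K1 K2) K3) as K.
  eapply Rle_trans. apply K.
  replace (e * Cmod (w - z) * B + B * (e * Cmod (w - z)) + B * e * Cmod (w - z))
    with (3 * (e * B) * Cmod (w - z)) by ring.
  rewrite HeB. lra.
Qed.

Lemma cderiv_minus f g z df dg :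
  cderiv f z df -> cderiv g z dg -> cderiv (fun w => f w - g w)%C z (df - dg).
Proof.
  intros Hf Hg.
  pose proof (cderiv_plus _ _ _ _ _ Hf
                (cderiv_mult _ _ _ _ _ (cderiv_const (- (1)) z) Hg)) as H.
  intros eps He. destruct (H eps He) as [d [Hd H']]. exists d. split; auto.
  intros w Hw. specialize (H' w Hw).
  replace (f w - g w - (f z - g z) - (df - dg) * (w - z))%C with
    (f w + - (1) * g w - (f z + - (1) * g z) - (df + (0 * g z + - (1) * dg)) * (w - z))%C by ring.
  exact H'.
Qed.

Lemma cderiv_inv (z : C) : z <> 0 -> cderiv Cinv z (- / (z * z)).
Proof.
  intros Hz eps He.
  assert (Hm : 0 < Cmod z) by now apply Cmod_gt_0.
  set (m := Cmod z) in *.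
  exists (Rmin (m / 2) (eps * (m * m * m) / 2)). split.
  { apply Rmin_pos. lra. assert (0 < m * m * m) by (repeat apply Rmult_lt_0_compat; auto). nra. }
  intros w Hw.
  pose proof (Rmin_l (m / 2) (eps * (m * m * m) / 2)).
  pose proof (Rmin_r (m / 2) (eps * (m * m * m) / 2)).
  assert (Hw2 : m / 2 <= Cmod w).
  { pose proof (Cmod_minus_ge z w). rewrite Cmod_minus_sym in H1. fold m in H1. lra. }
  assert (Hw0 : w <> 0) by (apply Cmod_gt_0; lra).
  replace (/ w - / z - - / (z * z) * (w - z))%C
    with ((w - z) * (/ (z * z * w)) * (w - z))%C by (field; auto).
  rewrite Cmod_mult. apply Rmult_le_compat_r. apply Cmod_ge_0.
  rewrite Cmod_mult, Cmod_inv, !Cmod_mult by (repeat apply Cmult_neq_0; auto). fold m.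
  assert (0 < m * m) by nra.
  assert (m * m * (m / 2) <= m * m * Cmod w) by (apply Rmult_le_compat_l; lra).
  apply Rmult_le_reg_r with (m * m * Cmod w). nra.
  replace (Cmod (w - z) * / (m * m * Cmod w) * (m * m * Cmod w)) with (Cmod (w - z))
    by (field; split; lra).
  apply Rle_trans with (eps * (m * m * m) / 2). lra.
  apply Rle_trans with (eps * (m * m * (m / 2))). right; field.
  apply Rmult_le_compat_l; lra.
Qed.

Lemma ccont_plus f g z : ccont f z -> ccont g z -> ccont (fun w => f w + g w)%C z.
Proof.
  intros Hf Hg eps He.
  destruct (Hf (eps / 2) ltac:(lra)) as [d1 [Hd1 H1]].
  destruct (Hg (eps / 2) ltac:(lra)) as [d2 [Hd2 H2]].
  exists (Rmin d1 d2). split. { now apply Rmin_pos. }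
  intros w Hw. pose proof (Rmin_l d1 d2). pose proof (Rmin_r d1 d2).
  specialize (H1 w ltac:(lra)). specialize (H2 w ltac:(lra)).
  replace (f w + g w - (f z + g z))%C with ((f w - f z) + (g w - g z))%C by ring.
  replace eps with (eps / 2 + eps / 2) by field. now apply Cmod_triangle_le.
Qed.

Lemma ccont_mult f g z : ccont f z -> ccont g z -> ccont (fun w => f w * g w)%C z.
Proof.
  intros Hf Hg eps He.
  set (B := 1 + Cmod (g z) + Cmod (f z)).
  pose proof (Cmod_ge_0 (g z)). pose proof (Cmod_ge_0 (f z)).
  assert (HB : 1 <= B) by (unfold B; lra).
  set (e := eps / (2 * B)).
  assert (He' : 0 < e) by (apply Rdiv_lt_0_compat; lra).
  destruct (Hf e He') as [d1 [Hd1 H1]].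
  destruct (Hg (Rmin 1 e) ltac:(apply Rmin_pos; lra)) as [d2 [Hd2 H2]].
  exists (Rmin d1 d2). split. { now apply Rmin_pos. }
  intros w Hw. pose proof (Rmin_l d1 d2). pose proof (Rmin_r d1 d2).
  pose proof (Rmin_l 1 e). pose proof (Rmin_r 1 e).
  specialize (H1 w ltac:(lra)). specialize (H2 w ltac:(lra)).
  replace (f w * g w - f z * g z)%C with ((f w - f z) * g w + f z * (g w - g z))%C by ring.
  replace eps with (e * B + B * e) by (unfold e; field; lra).
  apply Cmod_triangle_le; apply Cmod_mult_le; try lra.
  - pose proof (Cmod_minus_ge (g w) (g z)). unfold B. lra.
  - unfold B; lra.
Qed.

Lemma cderiv_eq f z d1 d2 : cderiv f z d1 -> d1 = d2 -> cderiv f z d2.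
Proof. intros H <-. exact H. Qed.

Lemma Cmod_eq_0_le_all (z : C) (q : R) : 0 <= q ->
  (forall eps, 0 < eps -> Cmod z <= eps * q) -> z = 0.
Proof.
  intros Hq H. apply Cmod_eq_0. pose proof (Cmod_ge_0 z) as Hz.
  destruct (Rle_lt_or_eq_dec _ _ Hz) as [Hlt|]; auto. exfalso.
  specialize (H (Cmod z / (2 * (q + 1))) ltac:(apply Rdiv_lt_0_compat; lra)).
  apply Rmult_le_compat_r with (r := 2 * (q + 1)) in H; [|lra].
  replace (Cmod z / (2 * (q + 1)) * q * (2 * (q + 1))) with (Cmod z * q) in H
    by (field; lra). nra.
Qed.

Lemma cderiv_shift f w z D : cderiv f (z - w) D -> cderiv (fun u => f (u - w))%C z D.
Proof.
  intros H eps He. destruct (H eps He) as [delta [Hd H']].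
  exists delta. split; auto. intros u Hu.
  specialize (H' (u - w)%C). replace (u - w - (z - w))%C with (u - z)%C in H' by ring. auto.
Qed.

Lemma cderiv_inv_shift (w z : C) : z <> w ->
  cderiv (fun u => / (u - w))%C z (- / ((z - w) * (z - w))).
Proof. intros H. apply cderiv_shift, cderiv_inv. now apply Cminus_eq_contra. Qed.

Lemma ccont_inv (z : C) : z <> 0 -> ccont Cinv z.
Proof. intros H. eapply cderiv_ccont, cderiv_inv, H. Qed.

Lemma ccont_const (k z : C) : ccont (fun _ => k) z.
Proof. apply (cderiv_ccont _ _ _ (cderiv_const _ _)). Qed.

Lemma ccont_pow f z n : ccont f z -> ccont (fun u => f u ^ n)%C z.
Proof.
  intros H. induction n as [|n IH]; simpl.
  apply ccont_const. now apply (ccont_mult f (fun u => f u ^ n)%C).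
Qed.

Lemma ccont_inv_shift (w z : C) : z <> w -> ccont (fun u => / (u - w))%C z.
Proof. intros. eapply cderiv_ccont, cderiv_inv_shift; auto. Qed.

Lemma Cmod_inv_le (z : C) r : 0 < r -> r <= Cmod z -> Cmod (/ z) <= / r.
Proof.
  intros Hr Hz. rewrite Cmod_inv. now apply Rinv_le_contravar.
  apply Cmod_gt_0. lra.
Qed.

Lemma cderiv_inv_pow (z : C) n : z <> 0 ->
  cderiv (fun u => (/ u) ^ n)%C z (- (RtoC (INR n)) * (/ z) ^ S n).
Proof.
  intros Hz. induction n as [|n IH].
  - eapply cderiv_eq. apply (cderiv_const 1). simpl. ring.
  - eapply cderiv_eq. apply (cderiv_mult Cinv (fun u => (/ u) ^ n)%C).
    now apply cderiv_inv. apply IH.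
    rewrite S_INR, RtoC_plus. simpl.
    replace (/ (z * z))%C with (/ z * / z)%C by (field; auto). ring.
Qed.

(** Both sides have the same quantifiers: the source of [f] is [C] as an
    absolute-value ring, so its balls are discs. *)
Lemma is_derive_cderiv (f : C -> C) (z d : C) :
  @is_derive C_AbsRing C_NormedModule f z d <-> cderiv f z d.
Proof.
  split.
  - intros [_ H] eps He.
    specialize (H z (fun P HP => HP) (mkposreal eps He)).
    destruct H as [delta H]. exists delta. split. apply cond_pos.
    intros w Hw. specialize (H w Hw). simpl in H.
    replace (d * (w - z))%C with ((w - z) * d)%C by ring.
    exact H.
  - intros H. split. apply is_linear_scal_l.
    intros x Hx eps.
    apply (is_filter_lim_locally_unique (K := C_AbsRing) (V := AbsRing_NormedModule C_AbsRing)) in Hx.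
    subst x.
    destruct (H eps (cond_pos eps)) as [delta [Hd H']].
    exists (mkposreal delta Hd). intros w Hw. specialize (H' w Hw).
    replace (d * (w - z))%C with ((w - z) * d)%C in H' by ring.
    exact H'.
Qed.

(** The uniform structure on [C] is here that of the product [R * R], whose
    balls are squares; discs and squares contain each other up to a factor. *)
Lemma locally_disc (P : C -> Prop) :
  @locally C_UniformSpace (RtoC 0) P <->
  exists r, 0 < r /\ forall z, Cmod z < r -> P z.
Proof.
  split.
  - intros [e H]. exists e. split. apply cond_pos. intros z Hz. apply H.
    pose proof (Rmax_Cmod z) as K.
    pose proof (Rmax_l (Rabs (fst z)) (Rabs (snd z))).
    pose proof (Rmax_r (Rabs (fst z)) (Rabs (snd z))).
    split; unfold ball; simpl; unfold AbsRing_ball, abs, minus, plus, opp; simpl;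
      rewrite Ropp_0, Rplus_0_r; lra.
  - intros [r [Hr H]].
    assert (Hr2 : 0 < r / 2) by lra.
    exists (mkposreal _ Hr2). intros z [H1 H2]. apply H.
    unfold ball in H1, H2; simpl in H1, H2;
      unfold AbsRing_ball, abs, minus, plus, opp in H1, H2; simpl in H1, H2.
    rewrite Ropp_0, Rplus_0_r in H1, H2.
    pose proof (Cmod_2Rmax z).
    assert (Rmax (Rabs (fst z)) (Rabs (snd z)) < r / 2) by now apply Rmax_lub_lt.
    assert (sqrt 2 <= 2). { rewrite <- (sqrt_Rsqr 2) at 2 by lra. apply sqrt_le_1_alt. unfold Rsqr; lra. }
    pose proof (Rabs_pos (fst z)).
    pose proof (Rmax_l (Rabs (fst z)) (Rabs (snd z))).
    nra.
Qed.

Lemma holomorphic_disc (f : C -> C) :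
  holomorphic_near_0 f <->
  exists r, 0 < r /\ forall z, Cmod z < r -> exists d, cderiv f z d.
Proof.
  unfold holomorphic_near_0. rewrite locally_disc.
  split; intros [r [Hr H]]; exists r; split; auto; intros z Hz;
    destruct (H z Hz) as [d Hd]; exists d; now apply is_derive_cderiv.
Qed.

(** * Integrals over segments and rectangles *)

Definition path_cont (g : R -> C) (a b : R) : Prop :=
  forall t, a <= t <= b ->
    continuous (fun s => fst (g s)) t /\ continuous (fun s => snd (g s)) t.

(** Integrating real and imaginary parts separately reduces everything to the
    real Riemann integral; the price is the factor 2 in [CInt_bound]. *)
Definition CInt (g : R -> C) (a b : R) : C :=
  (RInt (fun t => fst (g t)) a b, RInt (fun t => snd (g t)) a b).

Definition line (q e : C) (t : R) : C := (q + e * t)%C.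

(** The integral of [f z dz] over the segment from [q + e a] to [q + e b].
    The parameter is the abscissa or ordinate itself rather than a normalized
    one, so that cutting an edge needs no change of variable. *)
Definition seg_int (f : C -> C) (q e : C) (a b : R) : C :=
  (e * CInt (fun t => f (line q e t)) a b)%C.

Lemma path_cont_ex_RInt g a b : a <= b -> path_cont g a b ->
  ex_RInt (fun t => fst (g t)) a b /\ ex_RInt (fun t => snd (g t)) a b.
Proof.
  intros Hab H.
  split; apply (ex_RInt_continuous (V := R_CompleteNormedModule));
    intros t; rewrite Rmin_left, Rmax_right by auto; intros Ht; now apply H.
Qed.

Lemma CInt_bound g a b M : a <= b -> path_cont g a b ->
  (forall t, a <= t <= b -> Cmod (g t) <= M) ->
  Cmod (CInt g a b) <= 2 * M * (b - a).
Proof.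
  intros Hab Hc HM. destruct (path_cont_ex_RInt _ _ _ Hab Hc) as [E1 E2].
  eapply Rle_trans. apply Cmod_le_abs. unfold CInt; simpl.
  replace (2 * M * (b - a)) with ((b - a) * M + (b - a) * M) by ring.
  apply Rplus_le_compat; apply abs_RInt_le_const; auto; intros t Ht;
    specialize (HM t Ht); eapply Rle_trans; try apply HM;
    auto using fst_le_Cmod, snd_le_Cmod.
Qed.

Lemma CInt_plus g h a b : a <= b -> path_cont g a b -> path_cont h a b ->
  CInt (fun t => g t + h t)%C a b = (CInt g a b + CInt h a b)%C.
Proof.
  intros Hab Hg Hh.
  destruct (path_cont_ex_RInt _ _ _ Hab Hg). destruct (path_cont_ex_RInt _ _ _ Hab Hh).
  unfold CInt. apply injective_projections; simpl.
  - apply (RInt_plus (fun t => fst (g t)) (fun t => fst (h t))); auto.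
  - apply (RInt_plus (fun t => snd (g t)) (fun t => snd (h t))); auto.
Qed.

Lemma CInt_scal k g a b : a <= b -> path_cont g a b ->
  CInt (fun t => k * g t)%C a b = (k * CInt g a b)%C.
Proof.
  intros Hab Hg.
  destruct (path_cont_ex_RInt _ _ _ Hab Hg) as [E1 E2].
  destruct k as [k1 k2].
  pose proof (ex_RInt_scal (V := R_NormedModule) _ a b k1 E1) as A1.
  pose proof (ex_RInt_scal (V := R_NormedModule) _ a b k2 E1) as A2.
  pose proof (ex_RInt_scal (V := R_NormedModule) _ a b k1 E2) as A3.
  pose proof (ex_RInt_scal (V := R_NormedModule) _ a b k2 E2) as A4.
  pose proof (RInt_scal (V := R_CompleteNormedModule) _ a b k1 E1) as B1.
  pose proof (RInt_scal (V := R_CompleteNormedModule) _ a b k2 E1) as B2.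
  pose proof (RInt_scal (V := R_CompleteNormedModule) _ a b k1 E2) as B3.
  pose proof (RInt_scal (V := R_CompleteNormedModule) _ a b k2 E2) as B4.
  unfold CInt, Cmult; apply injective_projections; simpl.
  - etransitivity. apply (RInt_minus (V := R_CompleteNormedModule) _ _ a b A1 A4).
    etransitivity. apply (f_equal2 minus B1 B4). reflexivity.
  - etransitivity. apply (RInt_plus (V := R_CompleteNormedModule) _ _ a b A3 A2).
    etransitivity. apply (f_equal2 plus B3 B2). reflexivity.
Qed.

Lemma CInt_Chasles g a m b : a <= m <= b -> path_cont g a b ->
  CInt g a b = (CInt g a m + CInt g m b)%C.
Proof.
  intros [Ham Hmb] H.
  assert (H1 : path_cont g a m) by (intros t Ht; apply H; lra).
  assert (H2 : path_cont g m b) by (intros t Ht; apply H; lra).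
  destruct (path_cont_ex_RInt _ _ _ Ham H1). destruct (path_cont_ex_RInt _ _ _ Hmb H2).
  unfold CInt. apply injective_projections; simpl; symmetry.
  - apply (RInt_Chasles (fun t => fst (g t))); auto.
  - apply (RInt_Chasles (fun t => snd (g t))); auto.
Qed.

Lemma CInt_ext g h a b : a <= b -> (forall t, a <= t <= b -> g t = h t) ->
  CInt g a b = CInt h a b.
Proof.
  intros Hab H. unfold CInt. f_equal; apply RInt_ext; intros t;
    rewrite Rmin_left, Rmax_right by auto; intros Ht; rewrite H; auto; lra.
Qed.

Lemma line_minus q e s t : (line q e s - line q e t)%C = (e * (s - t))%C.
Proof. unfold line. ring. Qed.

Lemma Cmod_line_minus q e s t :
  Cmod (line q e s - line q e t) = Cmod e * Rabs (s - t).
Proof. rewrite line_minus, Cmod_mult, <- RtoC_minus, Cmod_R. reflexivity. Qed.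

Lemma line_cont f q e a b :
  (forall t, a <= t <= b -> ccont f (line q e t)) ->
  path_cont (fun t => f (line q e t)) a b.
Proof.
  intros H t Ht.
  assert (K : forall eps : posreal, exists delta : posreal, forall s,
    Rabs (s - t) < delta -> Cmod (f (line q e s) - f (line q e t)) < eps).
  { intros eps. pose proof (cond_pos eps) as He.
    destruct (H t Ht (eps / 2) ltac:(lra)) as [d [Hd Hf]].
    assert (He1 : 0 < Cmod e + 1) by (pose proof (Cmod_ge_0 e); lra).
    assert (Hd1 : 0 < d / (Cmod e + 1)) by now apply Rdiv_lt_0_compat.
    exists (mkposreal _ Hd1). intros s Hs. simpl in Hs.
    eapply Rle_lt_trans. apply Hf. 2: lra.
    rewrite Cmod_line_minus.
    apply Rmult_lt_compat_l with (r := Cmod e + 1) in Hs; auto.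
    replace ((Cmod e + 1) * (d / (Cmod e + 1))) with d in Hs by (field; lra).
    pose proof (Rabs_pos (s - t)). lra. }
  split; intros P [eps HP]; destruct (K eps) as [d Hd]; exists d; intros s Hs;
    apply HP; specialize (Hd s Hs).
  - eapply Rle_lt_trans. 2: apply Hd. apply (fst_le_Cmod (f (line q e s) - f (line q e t))).
  - eapply Rle_lt_trans. 2: apply Hd. apply (snd_le_Cmod (f (line q e s) - f (line q e t))).
Qed.

Lemma seg_bound f q e a b M : a <= b -> Cmod e <= 1 -> 0 <= M ->
  (forall t, a <= t <= b -> ccont f (line q e t)) ->
  (forall t, a <= t <= b -> Cmod (f (line q e t)) <= M) ->
  Cmod (seg_int f q e a b) <= 2 * M * (b - a).
Proof.
  intros Hab He HM Hc Hb. unfold seg_int. rewrite Cmod_mult.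
  pose proof (CInt_bound _ _ _ _ Hab (line_cont _ _ _ _ _ Hc) Hb).
  pose proof (Cmod_ge_0 e).
  pose proof (Cmod_ge_0 (CInt (fun t => f (line q e t)) a b)). nra.
Qed.

Lemma seg_plus f g q e a b : a <= b ->
  (forall t, a <= t <= b -> ccont f (line q e t)) ->
  (forall t, a <= t <= b -> ccont g (line q e t)) ->
  seg_int (fun z => f z + g z)%C q e a b = (seg_int f q e a b + seg_int g q e a b)%C.
Proof.
  intros. unfold seg_int. rewrite CInt_plus by (auto using line_cont). ring.
Qed.

Lemma seg_scal k f q e a b : a <= b ->
  (forall t, a <= t <= b -> ccont f (line q e t)) ->
  seg_int (fun z => k * f z)%C q e a b = (k * seg_int f q e a b)%C.
Proof.
  intros. unfold seg_int. rewrite CInt_scal by (auto using line_cont). ring.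
Qed.

Lemma seg_ext f g q e a b : a <= b ->
  (forall t, a <= t <= b -> f (line q e t) = g (line q e t)) ->
  seg_int f q e a b = seg_int g q e a b.
Proof. intros. unfold seg_int. erewrite CInt_ext; eauto. Qed.

Lemma seg_Chasles f q e a m b : a <= m <= b ->
  (forall t, a <= t <= b -> ccont f (line q e t)) ->
  seg_int f q e a b = (seg_int f q e a m + seg_int f q e m b)%C.
Proof.
  intros. unfold seg_int. rewrite (CInt_Chasles _ a m b) by (auto using line_cont). ring.
Qed.

(** Along the segment, [F] composed with the line has derivative [e * f], and
    the real fundamental theorem applies to each component. *)
Lemma seg_FTC F f q e a b : a <= b ->
  (forall t, a <= t <= b -> cderiv F (line q e t) (f (line q e t))) ->
  (forall t, a <= t <= b -> ccont f (line q e t)) ->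
  seg_int f q e a b = (F (line q e b) - F (line q e a))%C.
Proof.
  intros Hab HF Hf. unfold seg_int.
  rewrite <- CInt_scal by (auto using line_cont).
  assert (Hg : path_cont (fun t => e * f (line q e t))%C a b).
  { apply (line_cont (fun z => e * f z)%C). intros t Ht eps He.
    assert (H1 : 0 < Cmod e + 1) by (pose proof (Cmod_ge_0 e); lra).
    destruct (Hf t Ht (eps / (Cmod e + 1)) ltac:(now apply Rdiv_lt_0_compat)) as [d [Hd H]].
    exists d. split; auto. intros w Hw. specialize (H w Hw).
    replace (e * f w - e * f (line q e t))%C with (e * (f w - f (line q e t)))%C by ring.
    rewrite Cmod_mult.
    apply Rle_trans with ((Cmod e + 1) * (eps / (Cmod e + 1))).
    - apply Rmult_le_compat; auto using Cmod_ge_0. lra.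
    - right. field. lra. }
  assert (K : forall t, a <= t <= b -> forall eps : posreal, exists delta : posreal,
    forall s, Rabs (s - t) < delta ->
    Cmod (F (line q e s) - F (line q e t) - (e * f (line q e t)) * (s - t)) <= eps * Rabs (s - t)).
  { intros t Ht eps. pose proof (cond_pos eps) as He.
    assert (H1 : 0 < Cmod e + 1) by (pose proof (Cmod_ge_0 e); lra).
    destruct (HF t Ht (eps / (Cmod e + 1)) ltac:(now apply Rdiv_lt_0_compat)) as [d [Hd H]].
    assert (Hd1 : 0 < d / (Cmod e + 1)) by now apply Rdiv_lt_0_compat.
    exists (mkposreal _ Hd1). intros s Hs. simpl in Hs.
    specialize (H (line q e s)). rewrite Cmod_line_minus, line_minus in H.
    replace (e * f (line q e t) * (s - t))%C with (f (line q e t) * (e * (s - t)))%C by ring.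
    pose proof (Rabs_pos (s - t)) as Hp.
    assert (Hlt : Cmod e * Rabs (s - t) < d).
    { apply Rmult_lt_compat_l with (r := Cmod e + 1) in Hs; auto.
      replace ((Cmod e + 1) * (d / (Cmod e + 1))) with d in Hs by (field; lra). lra. }
    eapply Rle_trans. apply H; auto.
    rewrite <- Rmult_assoc. apply Rmult_le_compat_r; auto.
    apply Rle_trans with (eps / (Cmod e + 1) * (Cmod e + 1)).
    - apply Rmult_le_compat_l. left; now apply Rdiv_lt_0_compat. lra.
    - right; field; lra. }
  assert (HP : forall p : C -> R, p = fst \/ p = snd ->
    is_RInt (fun t => p (e * f (line q e t))%C) a b
      (p (F (line q e b)) - p (F (line q e a)))).
  { intros p Hp.
    apply (is_RInt_derive (V := R_CompleteNormedModule) (fun t => p (F (line q e t))));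
      intros t; rewrite Rmin_left, Rmax_right by auto; intros Ht.
    - split. apply is_linear_scal_l. intros x Hx eps.
      apply (is_filter_lim_locally_unique (K := R_AbsRing) (V := R_NormedModule)) in Hx.
      subst x. destruct (K t Ht eps) as [d Hd]. exists d. intros s Hs.
      eapply Rle_trans. 2: apply (Hd s Hs).
      destruct Hp as [-> | ->];
        [eapply Rle_trans; [right | apply fst_le_Cmod]
        |eapply Rle_trans; [right | apply snd_le_Cmod]];
        unfold norm, minus, plus, opp, scal; simpl; unfold abs, mult; simpl; f_equal; ring.
    - destruct Hp as [-> | ->]; [exact (proj1 (Hg t Ht)) | exact (proj2 (Hg t Ht))]. }
  unfold CInt. apply injective_projections; apply is_RInt_unique.
  - apply (HP fst). now left.
  - apply (HP snd). now right.
Qed.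

Definition in_rect (a b c d : R) (z : C) : Prop :=
  a <= fst z <= b /\ c <= snd z <= d.

Definition on_boundary (a b c d : R) (z : C) : Prop :=
  in_rect a b c d z /\ (fst z = a \/ fst z = b \/ snd z = c \/ snd z = d).

(** The boundary is run counterclockwise; the horizontal edges lie on the lines
    through [(0, c)] and [(0, d)] with direction 1, the vertical ones on the lines
    through [(a, 0)] and [(b, 0)] with direction [Ci]. *)
Definition rect_int (f : C -> C) (a b c d : R) : C :=
  (seg_int f (0, c) 1 a b + seg_int f (b, 0) Ci c d
   - seg_int f (0, d) 1 a b - seg_int f (a, 0) Ci c d)%C.

Lemma line_h c t : line (0, c) 1 t = (t, c).
Proof. unfold line, Cmult, Cplus; simpl. f_equal; ring. Qed.

Lemma line_v a t : line (a, 0) Ci t = (a, t).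
Proof. unfold line, Cmult, Cplus; simpl. f_equal; ring. Qed.

Lemma on_boundary_edges (P : C -> Prop) a b c d : a <= b -> c <= d ->
  (forall z, on_boundary a b c d z -> P z) ->
  (forall t, a <= t <= b -> P (line (0, c) 1 t)) /\
  (forall t, c <= t <= d -> P (line (b, 0) Ci t)) /\
  (forall t, a <= t <= b -> P (line (0, d) 1 t)) /\
  (forall t, c <= t <= d -> P (line (a, 0) Ci t)).
Proof.
  intros Hab Hcd H. repeat split; intros t Ht; rewrite ?line_h, ?line_v; apply H;
    unfold on_boundary, in_rect; simpl; (split; [lra | auto]).
Qed.

Lemma rect_int_bound f a b c d M : a <= b -> c <= d -> 0 <= M ->
  (forall z, on_boundary a b c d z -> ccont f z) ->
  (forall z, on_boundary a b c d z -> Cmod (f z) <= M) ->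
  Cmod (rect_int f a b c d) <= 4 * M * ((b - a) + (d - c)).
Proof.
  intros Hab Hcd HM Hc Hb.
  apply on_boundary_edges in Hc; auto. apply on_boundary_edges in Hb; auto.
  destruct Hc as (C1 & C2 & C3 & C4). destruct Hb as (B1 & B2 & B3 & B4).
  unfold rect_int.
  assert (Hci : Cmod Ci <= 1) by (rewrite Cmod_Ci; lra).
  assert (H1 : Cmod 1 <= 1) by (rewrite Cmod_1; lra).
  pose proof (seg_bound _ _ _ _ _ _ Hab H1 HM C1 B1).
  pose proof (seg_bound _ _ _ _ _ _ Hcd Hci HM C2 B2).
  pose proof (seg_bound _ _ _ _ _ _ Hab H1 HM C3 B3).
  pose proof (seg_bound _ _ _ _ _ _ Hcd Hci HM C4 B4).
  eapply Rle_trans. apply Cmod_triangle_minus.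
  eapply Rle_trans. apply Rplus_le_compat_r. apply Cmod_triangle_minus.
  eapply Rle_trans. apply Rplus_le_compat_r, Rplus_le_compat_r. apply Cmod_triangle.
  lra.
Qed.

Lemma rect_int_plus f g a b c d : a <= b -> c <= d ->
  (forall z, on_boundary a b c d z -> ccont f z) ->
  (forall z, on_boundary a b c d z -> ccont g z) ->
  rect_int (fun z => f z + g z)%C a b c d = (rect_int f a b c d + rect_int g a b c d)%C.
Proof.
  intros Hab Hcd Hf Hg.
  apply on_boundary_edges in Hf; auto. apply on_boundary_edges in Hg; auto.
  unfold rect_int. rewrite !seg_plus by tauto. ring.
Qed.

Lemma rect_int_scal k f a b c d : a <= b -> c <= d ->
  (forall z, on_boundary a b c d z -> ccont f z) ->
  rect_int (fun z => k * f z)%C a b c d = (k * rect_int f a b c d)%C.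
Proof.
  intros Hab Hcd Hf.
  apply on_boundary_edges in Hf; auto.
  unfold rect_int. rewrite !seg_scal by tauto. ring.
Qed.

Lemma rect_int_ext f g a b c d : a <= b -> c <= d ->
  (forall z, on_boundary a b c d z -> f z = g z) ->
  rect_int f a b c d = rect_int g a b c d.
Proof.
  intros Hab Hcd H. unfold rect_int.
  apply (on_boundary_edges (fun z => f z = g z)) in H; auto.
  destruct H as (H1 & H2 & H3 & H4).
  rewrite (seg_ext f g _ _ _ _ Hab H1), (seg_ext f g _ _ _ _ Hcd H2),
    (seg_ext f g _ _ _ _ Hab H3), (seg_ext f g _ _ _ _ Hcd H4). reflexivity.
Qed.

Lemma rect_int_primitive F f a b c d : a <= b -> c <= d ->
  (forall z, on_boundary a b c d z -> cderiv F z (f z)) ->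
  (forall z, on_boundary a b c d z -> ccont f z) ->
  rect_int f a b c d = 0.
Proof.
  intros Hab Hcd HF Hf.
  apply (on_boundary_edges (fun z => cderiv F z (f z))) in HF; auto.
  apply on_boundary_edges in Hf; auto.
  destruct Hf as (C1 & C2 & C3 & C4). destruct HF as (B1 & B2 & B3 & B4).
  unfold rect_int.
  rewrite (seg_FTC F f _ _ _ _ Hab B1 C1), (seg_FTC F f _ _ _ _ Hcd B2 C2),
    (seg_FTC F f _ _ _ _ Hab B3 C3), (seg_FTC F f _ _ _ _ Hcd B4 C4).
  rewrite !line_h, !line_v. ring.
Qed.

(** The common vertical edge is run in both directions and cancels, so [f] has
    to be continuous on the two horizontal edges only.  This matters in
    [goursat_removable], where [f] may be discontinuous inside. *)
Lemma rect_int_split_x f a m b c d : a <= m <= b ->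
  (forall x, a <= x <= b -> ccont f (x, c)) ->
  (forall x, a <= x <= b -> ccont f (x, d)) ->
  rect_int f a b c d = (rect_int f a m c d + rect_int f m b c d)%C.
Proof.
  intros Hm Hc Hd. unfold rect_int.
  rewrite (seg_Chasles f (0, c) 1 a m b), (seg_Chasles f (0, d) 1 a m b); auto;
    try (intros t Ht; rewrite line_h; auto). ring.
Qed.

Lemma rect_int_split_y f a b c m d : c <= m <= d ->
  (forall y, c <= y <= d -> ccont f (a, y)) ->
  (forall y, c <= y <= d -> ccont f (b, y)) ->
  rect_int f a b c d = (rect_int f a b c m + rect_int f a b m d)%C.
Proof.
  intros Hm Hc Hd. unfold rect_int.
  rewrite (seg_Chasles f (a, 0) Ci c m d), (seg_Chasles f (b, 0) Ci c m d); auto;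
    try (intros t Ht; rewrite line_v; auto). ring.
Qed.

(** * Goursat's lemma *)

Lemma halving_small (w delta : R) : 0 <= w -> 0 < delta ->
  exists N, forall n, (N <= n)%nat -> w * (1 / 2) ^ n < delta.
Proof.
  intros Hw Hd.
  destruct (pow_lt_1_zero (1 / 2) ltac:(rewrite Rabs_pos_eq; lra) (delta / (w + 1))
              ltac:(apply Rdiv_lt_0_compat; lra)) as [N HN].
  exists N. intros n Hn. specialize (HN n Hn).
  assert (0 < (1 / 2) ^ n) by (apply pow_lt; lra).
  rewrite Rabs_pos_eq in HN by lra.
  apply Rmult_lt_compat_l with (r := w + 1) in HN; [|lra].
  replace ((w + 1) * (delta / (w + 1))) with delta in HN by (field; lra). lra.
Qed.

(** The left ends increase and the right ends decrease, with gap tending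
    to 0. *)
Lemma nested_halves (x : nat -> R) (w : R) : 0 <= w ->
  (forall n, x (S n) = x n \/ x (S n) = x n + w * (1 / 2) ^ S n) ->
  exists X, forall n, x n <= X <= x n + w * (1 / 2) ^ n.
Proof.
  intros Hw Hx.
  assert (Hp : forall n, 0 <= w * (1 / 2) ^ n).
  { intros n. apply Rmult_le_pos; auto. apply pow_le; lra. }
  assert (Hi : forall n, x n <= x (S n)).
  { intros n. specialize (Hp (S n)). destruct (Hx n); lra. }
  assert (Hd : forall n, x (S n) + w * (1 / 2) ^ S n <= x n + w * (1 / 2) ^ n).
  { intros n. specialize (Hp n). simpl. destruct (Hx n) as [E|E]; rewrite E; simpl; lra. }
  destruct (ex_lim_seq_adj x (fun n => x n + w * (1 / 2) ^ n) Hi Hd) as ([l Hl] & [m Hm] & E).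
  { apply is_lim_seq_ext with (fun n => w * (1 / 2) ^ n). intros; ring.
    replace (Finite 0) with (Rbar_mult w 0) by (simpl; f_equal; ring).
    apply is_lim_seq_scal_l. apply is_lim_seq_geom. rewrite Rabs_pos_eq; lra. }
  rewrite (is_lim_seq_unique _ _ Hl), (is_lim_seq_unique _ _ Hm) in E.
  injection E as E. subst m.
  exists l. intros n. split.
  - exact (is_lim_seq_incr_compare _ _ Hl Hi n).
  - exact (is_lim_seq_decr_compare _ _ Hm Hd n).
Qed.

(** Induction by bisection: if the conclusion failed for the whole rectangle it
    would fail for one of its quarters, then for a quarter of that one, and so on;
    the rectangles so obtained shrink to a point, near which it holds.  Only
    rectangles that contain the point occur in the local hypothesis, so that the
    distance to the point is controlled by the size of the rectangle. *)
Lemma quartering (P : R -> R -> R -> R -> Prop) (a b c d : R) :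
  a <= b -> c <= d ->
  (forall a b c d, a <= b -> c <= d ->
     P a ((a + b) / 2) c ((c + d) / 2) -> P ((a + b) / 2) b c ((c + d) / 2) ->
     P a ((a + b) / 2) ((c + d) / 2) d -> P ((a + b) / 2) b ((c + d) / 2) d ->
     P a b c d) ->
  (forall x y, a <= x <= b -> c <= y <= d ->
     exists delta, 0 < delta /\ forall a' b' c' d',
       a' <= x <= b' -> c' <= y <= d' -> b' - a' < delta -> d' - c' < delta ->
       P a' b' c' d') ->
  P a b c d.
Proof.
  intros Hab Hcd Hstep Hloc. apply NNPP. intros HN.
  set (w := b - a). set (h := d - c).
  assert (Hw : 0 <= w) by (unfold w; lra). assert (Hh : 0 <= h) by (unfold h; lra).
  (* Rectangles of the [n]-th generation are recorded by their lower left
     corner. *)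
  set (good := fun n (p : R * R) =>
    P (fst p) (fst p + w * (1 / 2) ^ n) (snd p) (snd p + h * (1 / 2) ^ n)).
  assert (Hnext : forall np : nat * (R * R), exists q : R * R,
    ~ good (fst np) (snd np) -> ~ good (S (fst np)) q /\
      (fst q = fst (snd np) \/ fst q = fst (snd np) + w * (1 / 2) ^ S (fst np)) /\
      (snd q = snd (snd np) \/ snd q = snd (snd np) + h * (1 / 2) ^ S (fst np))).
  { intros [n [x y]]; cbn [fst snd].
    apply NNPP. intros HQ. apply HQ. exists (x, y). intros Hbad. exfalso.
    assert (K : forall q, (fst q = x \/ fst q = x + w * (1 / 2) ^ S n) ->
      (snd q = y \/ snd q = y + h * (1 / 2) ^ S n) -> good (S n) q).
    { intros q H1 H2. apply NNPP. intros H3. apply HQ. exists q. auto. }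
    apply Hbad. unfold good; cbn [fst snd].
    assert (0 <= (1 / 2) ^ n) by (apply pow_le; lra).
    assert (Ex : (x + (x + w * (1 / 2) ^ n)) / 2 = x + w * (1 / 2) ^ S n)
      by (simpl; field).
    assert (Ey : (y + (y + h * (1 / 2) ^ n)) / 2 = y + h * (1 / 2) ^ S n)
      by (simpl; field).
    assert (Ex' : x + w * (1 / 2) ^ n = x + w * (1 / 2) ^ S n + w * (1 / 2) ^ S n)
      by (simpl; field).
    assert (Ey' : y + h * (1 / 2) ^ n = y + h * (1 / 2) ^ S n + h * (1 / 2) ^ S n)
      by (simpl; field).
    apply Hstep; rewrite ?Ex, ?Ey, ?Ex', ?Ey'.
    - assert (0 <= (1 / 2) ^ S n) by (apply pow_le; lra). nra.
    - assert (0 <= (1 / 2) ^ S n) by (apply pow_le; lra). nra.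
    - apply (K (x, y)); auto.
    - apply (K (x + w * (1 / 2) ^ S n, y)); auto.
    - apply (K (x, y + h * (1 / 2) ^ S n)); auto.
    - apply (K (x + w * (1 / 2) ^ S n, y + h * (1 / 2) ^ S n)); auto. }
  set (next := fun np => proj1_sig (constructive_indefinite_description _ (Hnext np))).
  assert (Hn : forall np, ~ good (fst np) (snd np) -> ~ good (S (fst np)) (next np) /\
      (fst (next np) = fst (snd np) \/
       fst (next np) = fst (snd np) + w * (1 / 2) ^ S (fst np)) /\
      (snd (next np) = snd (snd np) \/
       snd (next np) = snd (snd np) + h * (1 / 2) ^ S (fst np))).
  { intros np. unfold next. now destruct (constructive_indefinite_description _ (Hnext np)). }
  clearbody next.
  set (p := fix p n := match n with O => (a, c) | S m => next (m, p m) end).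
  assert (Hbad : forall n, ~ good n (p n)).
  { induction n as [|n IH].
    - unfold good; simpl. unfold w, h.
      replace (a + (b - a) * 1) with b by ring. replace (c + (d - c) * 1) with d by ring.
      exact HN.
    - apply (Hn (n, p n)), IH. }
  destruct (nested_halves (fun n => fst (p n)) w Hw) as [X HX].
  { intros n. apply (Hn (n, p n)), Hbad. }
  destruct (nested_halves (fun n => snd (p n)) h Hh) as [Y HY].
  { intros n. apply (Hn (n, p n)), Hbad. }
  destruct (Hloc X Y) as [delta [Hdelta HP]].
  { specialize (HX 0%nat). simpl in HX. unfold w in HX. lra. }
  { specialize (HY 0%nat). simpl in HY. unfold h in HY. lra. }
  destruct (halving_small w delta Hw Hdelta) as [N1 H1].
  destruct (halving_small h delta Hh Hdelta) as [N2 H2].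
  set (n := Nat.max N1 N2).
  specialize (H1 n ltac:(unfold n; lia)). specialize (H2 n ltac:(unfold n; lia)).
  apply (Hbad n). apply HP; auto; lra.
Qed.

Lemma rect_int_quarters f a b c d : a <= b -> c <= d ->
  (forall z, in_rect a b c d z -> ccont f z) ->
  rect_int f a b c d =
    (rect_int f a ((a + b) / 2) c ((c + d) / 2) + rect_int f ((a + b) / 2) b c ((c + d) / 2)
     + rect_int f a ((a + b) / 2) ((c + d) / 2) d
     + rect_int f ((a + b) / 2) b ((c + d) / 2) d)%C.
Proof.
  intros Hab Hcd Hf.
  assert (K : forall x y, a <= x <= b -> c <= y <= d -> ccont f (x, y))
    by (intros; apply Hf; split; auto).
  rewrite (rect_int_split_y f a b c ((c + d) / 2) d);
    try (intros; apply K); try lra.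
  rewrite (rect_int_split_x f a ((a + b) / 2) b c ((c + d) / 2)),
    (rect_int_split_x f a ((a + b) / 2) b ((c + d) / 2) d);
    try (intros; apply K); try lra.
  ring.
Qed.

(** An affine function has a quadratic primitive. *)
Lemma rect_int_affine p k0 k1 a b c d : a <= b -> c <= d ->
  rect_int (fun z => k0 + k1 * (z - p))%C a b c d = 0.
Proof.
  intros Hab Hcd.
  assert (HA : forall z, cderiv (fun z => k0 + k1 * (z - p))%C z k1).
  { intros z. eapply cderiv_eq.
    - apply (cderiv_plus (fun _ => k0) (fun z => k1 * (z - p))%C).
      apply cderiv_const. apply (cderiv_mult (fun _ => k1) (fun z => z - p)%C).
      apply cderiv_const. apply (cderiv_minus (fun z => z) (fun _ => p)).
      apply cderiv_id. apply cderiv_const.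
    - ring. }
  apply (rect_int_primitive
    (fun z => k0 * z + (k1 * / 2) * ((z - p) * (z - p)))%C); auto.
  2: { intros z _. eapply cderiv_ccont. apply HA. }
  intros z _.
  assert (Hzp : cderiv (fun z => z - p)%C z 1).
  { eapply cderiv_eq. apply (cderiv_minus (fun z => z) (fun _ => p)).
    apply cderiv_id. apply cderiv_const. ring. }
  eapply cderiv_eq.
  - apply (cderiv_plus (fun z => k0 * z)%C (fun z => (k1 * / 2) * ((z - p) * (z - p)))%C).
    apply (cderiv_mult (fun _ => k0) (fun z => z)). apply cderiv_const. apply cderiv_id.
    apply (cderiv_mult (fun _ => k1 * / 2)%C (fun z => ((z - p) * (z - p))%C)).
    apply cderiv_const. apply (cderiv_mult (fun z => z - p)%C (fun z => z - p)%C); exact Hzp.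
  - field.
Qed.

(** The bound [|integral| <= eps * s^2], with [s] the sum of the two side lengths,
    is stable under quartering because [s] is halved and there are four quarters.
    Near a point of differentiability it holds because the affine approximation
    integrates to 0 and the remainder is at most [(eps / 4) * s] on a boundary of
    length [2 s].  Hence it holds for the whole rectangle and for every [eps]. *)
Theorem goursat f a b c d : a <= b -> c <= d ->
  (forall z, in_rect a b c d z -> exists D, cderiv f z D) ->
  rect_int f a b c d = 0.
Proof.
  intros Hab Hcd Hf.
  assert (Hfc : forall z, in_rect a b c d z -> ccont f z).
  { intros z Hz. destruct (Hf z Hz) as [D HD]. eapply cderiv_ccont; eauto. }
  apply Cmod_eq_0_le_all with (((b - a) + (d - c)) * ((b - a) + (d - c))). nra.
  intros eps He.
  set (Q := fun a' b' c' d' => a <= a' -> b' <= b -> c <= c' -> d' <= d ->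
    Cmod (rect_int f a' b' c' d')
      <= eps * (((b' - a') + (d' - c')) * ((b' - a') + (d' - c')))).
  cut (Q a b c d). { intros H; apply H; lra. }
  apply quartering; auto.
  - intros a' b' c' d' Hab' Hcd' H1 H2 H3 H4 Ha Hb Hc Hd.
    rewrite rect_int_quarters; auto.
    2: { intros z [Hz1 Hz2]. apply Hfc. split; lra. }
    eapply Rle_trans.
    { apply Cmod_triangle_le. apply Cmod_triangle_le. apply Cmod_triangle_le.
      apply H1; lra. apply H2; lra. apply H3; lra. apply H4; lra. }
    right. field.
  - intros x y Hx Hy.
    destruct (Hf (x, y)) as [D HD]. { split; auto. }
    destruct (HD (eps / 4) ltac:(lra)) as [delta [Hdelta H]].
    exists (delta / 2). split. lra.
    intros a' b' c' d' Hx' Hy' Hw Hh Ha Hb Hc Hd.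
    set (s := (b' - a') + (d' - c')).
    assert (Hs : 0 <= s) by (unfold s; lra).
    set (r := fun z => (f z - (f (x, y) + D * (z - (x, y))))%C).
    assert (Hsub : forall z, on_boundary a' b' c' d' z -> in_rect a b c d z).
    { intros z [[Hz1 Hz2] _]. split; lra. }
    assert (Haff : forall z, cderiv (fun z => f (x, y) + D * (z - (x, y)))%C z
       (0 + (0 * (z - (x, y)) + D * (1 - 0)))).
    { intros z.
      apply (cderiv_plus (fun _ => f (x, y)) (fun z => D * (z - (x, y)))%C).
      apply cderiv_const. apply (cderiv_mult (fun _ => D) (fun z => z - (x, y))%C).
      apply cderiv_const. apply (cderiv_minus (fun z => z) (fun _ => (x, y))).
      apply cderiv_id. apply cderiv_const. }
    assert (Hr : forall z, on_boundary a' b' c' d' z -> ccont r z).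
    { intros z Hz. destruct (Hf z (Hsub z Hz)) as [Dz HDz].
      eapply cderiv_ccont. apply (cderiv_minus f); [apply HDz | apply Haff]. }
    rewrite (rect_int_ext f (fun z => (f (x, y) + D * (z - (x, y))) + r z)%C)
      by (try lra; intros z _; unfold r; ring).
    rewrite (rect_int_plus (fun z => (f (x, y) + D * (z - (x, y))))%C r); auto; try lra.
    2: { intros z _. eapply cderiv_ccont. apply Haff. }
    rewrite rect_int_affine by lra. rewrite Cplus_0_l.
    replace (eps * (s * s)) with (4 * (eps / 4 * s) * s) by field.
    apply rect_int_bound; auto; try lra. nra.
    intros z Hz.
    assert (Hzs : Cmod (z - (x, y)) <= s).
    { destruct Hz as [[Hz1 Hz2] _]. eapply Rle_trans. apply Cmod_le_abs.
      unfold s. destruct z as [z1 z2]. simpl in *.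
      apply Rplus_le_compat; apply Rabs_le; lra. }
    unfold r. replace (f z - (f (x, y) + D * (z - (x, y))))%C
      with (f z - f (x, y) - D * (z - (x, y)))%C by ring.
    eapply Rle_trans. apply H. unfold s in Hzs; lra.
    apply Rmult_le_compat_l; lra.
Qed.

(** * Asymptotic expansions *)

(** The partial sum [sum_{n<N} c_n z^n] in Horner form, so that inductions on the
    order peel off the constant term. *)
Fixpoint psum (c : nat -> C) (N : nat) (z : C) : C :=
  match N with
  | O => 0
  | S n => (c O + z * psum (fun k => c (S k)) n z)%C
  end.

(** The origin is left out, so that one may divide by [z] without giving the
    quotient a value at 0. *)
Definition expands (N : nat) (f : C -> C) (c : nat -> C) : Prop :=
  exists K delta, 0 < delta /\ forall z : C, z <> 0 -> Cmod z < delta ->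
    Cmod (f z - psum c N z) <= K * Cmod z ^ N.

Lemma expands_cons N f g c k0 delta : 0 < delta ->
  (forall z : C, z <> 0 -> Cmod z < delta -> f z = (k0 + z * g z)%C) ->
  k0 = c O -> expands N g (fun k => c (S k)) -> expands (S N) f c.
Proof.
  intros Hd Hf Hk (K & d & Hd1 & H).
  exists K, (Rmin delta d). split. now apply Rmin_pos.
  intros z Hz Hzd. pose proof (Rmin_l delta d). pose proof (Rmin_r delta d).
  specialize (H z Hz ltac:(lra)).
  rewrite Hf by (auto; lra). simpl. rewrite Hk.
  replace (c O + z * g z - (c O + z * psum (fun k => c (S k)) N z))%C
    with (z * (g z - psum (fun k => c (S k)) N z))%C by ring.
  rewrite Cmod_mult. pose proof (Cmod_ge_0 z). nra.
Qed.

Lemma psum_ext c c' N z : (forall n, c n = c' n) -> psum c N z = psum c' N z.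
Proof.
  revert c c'. induction N as [|N IH]; intros c c' E; simpl; auto.
  rewrite E, (IH (fun k => c (S k)) (fun k => c' (S k))); auto.
Qed.

Lemma expands_ext N f c c' : (forall n, c n = c' n) -> expands N f c -> expands N f c'.
Proof.
  intros E (K & d & Hd & H). exists K, d. split; auto.
  intros z. rewrite <- (psum_ext c c' N z E). apply H.
Qed.

Definition conv (c d : nat -> C) (n : nat) : C :=
  sum_n (fun k => (c k * d (n - k)%nat)%C) n.

Lemma conv_0 c d : conv c d 0 = (c O * d O)%C.
Proof. apply sum_O. Qed.

(** The recursion that matches the splitting [f z = c_0 + z * f1 z] of the left
    factor of a product. *)
Lemma conv_S c d n :
  conv c d (S n) = (c O * d (S n) + conv (fun k => c (S k)) d n)%C.
Proof.
  unfold conv, sum_n. rewrite sum_Sn_m by lia. f_equal.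
  now rewrite <- (sum_n_m_S (fun k => (c k * d (S n - k)%nat)%C)).
Qed.

Lemma psum_plus c d N z :
  psum (fun k => c k + d k)%C N z = (psum c N z + psum d N z)%C.
Proof.
  revert c d. induction N as [|N IH]; intros c d; simpl. ring.
  rewrite (IH (fun k => c (S k)) (fun k => d (S k))). ring.
Qed.

Lemma psum_scal k c N z : psum (fun n => k * c n)%C N z = (k * psum c N z)%C.
Proof.
  revert c. induction N as [|N IH]; intros c; simpl. ring.
  rewrite (IH (fun k => c (S k))). ring.
Qed.

Lemma psum_rot l c N z : psum (fun n => l ^ n * c n)%C N z = psum c N (l * z).
Proof.
  revert c. induction N as [|N IH]; intros c; simpl. ring.
  rewrite <- (IH (fun k => c (S k))).
  rewrite (psum_ext _ (fun k => l * (l ^ k * c (S k)))%C) by (intros; ring).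
  rewrite psum_scal. ring.
Qed.

Lemma expands_plus N f g c d : expands N f c -> expands N g d ->
  expands N (fun z => f z + g z)%C (fun n => c n + d n)%C.
Proof.
  intros (K1 & d1 & Hd1 & H1) (K2 & d2 & Hd2 & H2).
  exists (K1 + K2), (Rmin d1 d2). split. now apply Rmin_pos.
  intros z Hz Hzd. pose proof (Rmin_l d1 d2). pose proof (Rmin_r d1 d2).
  rewrite psum_plus.
  replace (f z + g z - (psum c N z + psum d N z))%C
    with ((f z - psum c N z) + (g z - psum d N z))%C by ring.
  rewrite Rmult_plus_distr_r.
  apply Cmod_triangle_le; [apply H1 | apply H2]; auto; lra.
Qed.

Lemma expands_scal k N f c : expands N f c ->
  expands N (fun z => k * f z)%C (fun n => k * c n)%C.
Proof.
  intros (K & d & Hd & H). exists (Cmod k * K), d. split; auto.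
  intros z Hz Hzd. rewrite psum_scal.
  replace (k * f z - k * psum c N z)%C with (k * (f z - psum c N z))%C by ring.
  rewrite Rmult_assoc. apply Cmod_mult_le. lra. auto.
Qed.

Lemma expands_rot l N f c : Cmod l = 1 -> expands N f c ->
  expands N (fun z => f (l * z)%C) (fun n => l ^ n * c n)%C.
Proof.
  intros Hl (K & d & Hd & H). exists K, d. split; auto.
  intros z Hz Hzd. rewrite psum_rot.
  assert (E : Cmod (l * z) = Cmod z) by (rewrite Cmod_mult, Hl; ring).
  rewrite <- E. apply H. 2: lra.
  apply Cmult_neq_0; auto. apply Cmod_gt_0. lra.
Qed.

Lemma expands_near N f g c delta : 0 < delta ->
  (forall z, Cmod z < delta -> f z = g z) -> expands N f c -> expands N g c.
Proof.
  intros Hd E (K & d & Hd' & H). exists K, (Rmin delta d). split. now apply Rmin_pos.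
  intros z Hz Hzd. pose proof (Rmin_l delta d). pose proof (Rmin_r delta d).
  rewrite <- E by lra. apply H; auto; lra.
Qed.

Lemma expands_tail N f c : expands (S N) f c ->
  expands N (fun z => (f z - c O) * / z)%C (fun k => c (S k)).
Proof.
  intros (K & d & Hd & H). exists K, d. split; auto.
  intros z Hz Hzd. specialize (H z Hz Hzd). simpl in H.
  assert (Hp : 0 < Cmod z) by now apply Cmod_gt_0.
  apply Rmult_le_reg_l with (Cmod z); auto. rewrite <- Cmod_mult.
  replace (z * ((f z - c O) * / z - psum (fun k => c (S k)) N z))%C
    with (f z - (c O + z * psum (fun k => c (S k)) N z))%C by (field; auto).
  lra.
Qed.

Lemma expands_pred N f c : expands (S N) f c -> expands N f c.
Proof.
  revert f c. induction N as [|N IH]; intros f c H.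
  - destruct H as (K & d & Hd & H).
    exists (Cmod (c O) + Rabs K * d), d. split; auto.
    intros z Hz Hzd. specialize (H z Hz Hzd). simpl in *.
    replace (f z - 0)%C with (c O + (f z - (c O + z * 0)))%C by ring.
    rewrite Rmult_1_r. apply Cmod_triangle_le. lra.
    eapply Rle_trans. apply H. rewrite Rmult_1_r.
    pose proof (Cmod_ge_0 z). pose proof (Rle_abs K). pose proof (Rabs_pos K). nra.
  - eapply (expands_cons N f (fun z => (f z - c O) * / z)%C c (c O) 1 Rlt_0_1); auto.
    + intros z Hz _. field. auto.
    + apply IH. now apply expands_tail.
Qed.

(** With [f z = c_0 + z f1 z] and [g z = d_0 + z g1 z] one has
    [f g = c_0 d_0 + z (c_0 g1 + f1 g)], and both summands in the parenthesis have
    an expansion to one order less, the second by induction. *)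
Lemma expands_mult N f g c d : expands N f c -> expands N g d ->
  expands N (fun z => f z * g z)%C (conv c d).
Proof.
  revert f g c d. induction N as [|N IH]; intros f g c d Hf Hg.
  - destruct Hf as (K1 & d1 & Hd1 & H1), Hg as (K2 & d2 & Hd2 & H2).
    exists (K1 * K2), (Rmin d1 d2). split. now apply Rmin_pos.
    intros z Hz Hzd. pose proof (Rmin_l d1 d2). pose proof (Rmin_r d1 d2).
    specialize (H1 z Hz ltac:(lra)). specialize (H2 z Hz ltac:(lra)). simpl in *.
    rewrite Rmult_1_r in *.
    replace (f z * g z - 0)%C with ((f z - 0) * (g z - 0))%C by ring.
    now apply Cmod_mult_le.
  - set (f1 := fun z => ((f z - c O) * / z)%C). set (g1 := fun z => ((g z - d O) * / z)%C).
    eapply (expands_cons N _ (fun z => c O * g1 z + f1 z * g z)%C _ (c O * d O)%C 1 Rlt_0_1).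
    + intros z Hz _. unfold f1, g1. field. auto.
    + now rewrite conv_0.
    + eapply expands_ext.
      2: apply (expands_plus N (fun z => c O * g1 z)%C (fun z => f1 z * g z)%C).
      2: apply expands_scal, expands_tail, Hg.
      2: apply IH. 2: apply expands_tail, Hf. 2: apply expands_pred, Hg.
      intros n. simpl. now rewrite conv_S.
Qed.

Lemma expands_1 N f c : expands (S N) f c -> expands 1 f c.
Proof. induction N; auto using expands_pred. Qed.

(** Both heads are the limit of [f] at 0; it is enough to approach 0 along the
    positive reals. *)
Lemma expands_head_unique N f c d :
  expands (S N) f c -> expands (S N) f d -> c O = d O.
Proof.
  intros Hc Hd. apply expands_1 in Hc, Hd.
  destruct Hc as (K1 & d1 & Hd1 & H1), Hd as (K2 & d2 & Hd2 & H2).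
  cut ((c O - d O)%C = 0).
  { intros E. replace (c O) with ((c O - d O) + d O)%C by ring. rewrite E. ring. }
  apply Cmod_eq_0_le_all with (Rabs K1 + Rabs K2).
  { pose proof (Rabs_pos K1). pose proof (Rabs_pos K2). lra. }
  intros eps He. set (t := Rmin eps (Rmin d1 d2 / 2)).
  assert (Ht : 0 < t).
  { apply Rmin_pos; auto. apply Rdiv_lt_0_compat. now apply Rmin_pos. lra. }
  assert (Hte : t <= eps) by apply Rmin_l.
  assert (Htd : t <= Rmin d1 d2 / 2) by apply Rmin_r.
  pose proof (Rmin_l d1 d2). pose proof (Rmin_r d1 d2).
  assert (E : Cmod (RtoC t) = t) by (rewrite Cmod_R; apply Rabs_pos_eq; lra).
  assert (Hne : RtoC t <> 0) by (apply Cmod_gt_0; lra).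
  specialize (H1 t Hne ltac:(lra)). specialize (H2 t Hne ltac:(lra)).
  rewrite E in H1, H2. simpl in H1, H2.
  replace (c O - d O)%C with (- (f t - (c O + t * 0)) + (f t - (d O + t * 0)))%C by ring.
  eapply Rle_trans. apply Cmod_triangle_le. rewrite Cmod_opp. apply H1. apply H2.
  pose proof (Rle_abs K1). pose proof (Rle_abs K2).
  pose proof (Rabs_pos K1). pose proof (Rabs_pos K2). nra.
Qed.

Lemma expands_unique f c d :
  (forall N, expands N f c) -> (forall N, expands N f d) -> forall n, c n = d n.
Proof.
  intros Hc Hd n. revert f c d Hc Hd. induction n as [|n IH]; intros f c d Hc Hd.
  - apply (expands_head_unique 0 f); auto.
  - apply (IH (fun z => (f z - c O) * / z)%C (fun k => c (S k)) (fun k => d (S k))).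
    + intros N. now apply expands_tail.
    + assert (E : c O = d O) by (apply (expands_head_unique 0 f); auto).
      rewrite E. intros N. now apply expands_tail.
Qed.

(** * Cauchy's integral formula on a square *)

(** Cutting off four rectangles that avoid [(u, v)] leaves an arbitrarily small
    square around it, on whose boundary [f] stays bounded by [M]. *)
Lemma goursat_removable f a b c d u v M : a < u < b -> c < v < d ->
  (forall z, in_rect a b c d z -> z <> (u, v) -> exists D, cderiv f z D) ->
  (exists delta, 0 < delta /\ forall z, z <> (u, v) -> Cmod (z - (u, v)) < delta ->
     Cmod (f z) <= M) ->
  rect_int f a b c d = 0.
Proof.
  intros Hu Hv Hf [delta [Hdelta HM]].
  assert (Hfc : forall z, in_rect a b c d z -> z <> (u, v) -> ccont f z).
  { intros z Hz Hzw. destruct (Hf z Hz Hzw) as [D HD]. eapply cderiv_ccont; eauto. }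
  assert (Hpt : forall x y : R, (x <> u \/ y <> v) -> (x, y) <> ((u, v) : C)).
  { intros x y Hxy E. injection E as E1 E2. tauto. }
  assert (HM0 : 0 <= Rabs M) by apply Rabs_pos.
  set (eta0 := Rmin (delta / 4) (Rmin (Rmin (u - a) (b - u)) (Rmin (v - c) (d - v)) / 2)).
  assert (H0 : 0 < eta0).
  { unfold eta0. apply Rmin_pos. lra. apply Rdiv_lt_0_compat; [|lra].
    repeat apply Rmin_pos; lra. }
  assert (Hside : forall eta, 0 < eta <= eta0 ->
    eta < u - a /\ eta < b - u /\ eta < v - c /\ eta < d - v).
  { intros eta Heta. unfold eta0 in Heta.
    pose proof (Rmin_r (delta / 4) (Rmin (Rmin (u - a) (b - u)) (Rmin (v - c) (d - v)) / 2)).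
    pose proof (Rmin_l (Rmin (u - a) (b - u)) (Rmin (v - c) (d - v))).
    pose proof (Rmin_r (Rmin (u - a) (b - u)) (Rmin (v - c) (d - v))).
    pose proof (Rmin_l (u - a) (b - u)). pose proof (Rmin_r (u - a) (b - u)).
    pose proof (Rmin_l (v - c) (d - v)). pose proof (Rmin_r (v - c) (d - v)). lra. }
  assert (Hshrink : forall eta, 0 < eta <= eta0 ->
    rect_int f a b c d = rect_int f (u - eta) (u + eta) (v - eta) (v + eta)).
  { intros eta Heta.
    pose proof (Hside eta Heta) as B.
    assert (G : forall a' b' c' d', a <= a' -> a' <= b' -> b' <= b ->
      c <= c' -> c' <= d' -> d' <= d ->
      (u < a' \/ b' < u \/ v < c' \/ d' < v) -> rect_int f a' b' c' d' = 0).
    { intros a' b' c' d' ? ? ? ? ? ? Hout. apply goursat; auto.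
      intros z [Hz1 Hz2]. apply Hf. split; lra.
      intros ->. simpl in *. lra. }
    rewrite (rect_int_split_x f a (u - eta) b c d),
      (rect_int_split_x f (u - eta) (u + eta) b c d);
      try lra; try (intros x Hx; apply Hfc; [split; simpl; lra | apply Hpt; lra]).
    rewrite (rect_int_split_y f (u - eta) (u + eta) c (v - eta) d),
      (rect_int_split_y f (u - eta) (u + eta) (v - eta) (v + eta) d);
      try lra; try (intros x Hx; apply Hfc; [split; simpl; lra | apply Hpt; lra]).
    rewrite (G a (u - eta) c d), (G (u + eta) b c d),
      (G (u - eta) (u + eta) c (v - eta)), (G (u - eta) (u + eta) (v + eta) d) by lra.
    ring. }
  apply Cmod_eq_0_le_all with (16 * Rabs M). lra.
  intros eps He.
  set (eta := Rmin eps eta0).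
  assert (Heta : 0 < eta <= eta0)
    by (unfold eta; split; [now apply Rmin_pos | apply Rmin_r]).
  assert (Heps : eta <= eps) by apply Rmin_l.
  assert (B : eta0 <= delta / 4) by apply Rmin_l.
  pose proof (Hside eta Heta) as B'.
  rewrite (Hshrink eta Heta).
  assert (Hoff : forall z, on_boundary (u - eta) (u + eta) (v - eta) (v + eta) z ->
    z <> (u, v)).
  { intros z [_ Hz] ->. simpl in Hz. lra. }
  eapply Rle_trans.
  - apply (rect_int_bound f) with (M := Rabs M); try lra.
    + intros z Hz. apply Hfc; auto. destruct Hz as [[Hz1 Hz2] _]. split; lra.
    + intros z Hz. eapply Rle_trans. 2: apply Rle_abs. apply HM; auto.
      destruct Hz as [[Hz1 Hz2] _].
      eapply Rle_lt_trans. apply Cmod_le_abs.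
      destruct z as [x y]. simpl in *.
      assert (Rabs (x + - u) <= eta) by (apply Rabs_le; lra).
      assert (Rabs (y + - v) <= eta) by (apply Rabs_le; lra). lra.
  - nra.
Qed.

Definition square_int (f : C -> C) (r : R) : C := rect_int f (- r) r (- r) r.

Definition on_square (r : R) (z : C) : Prop := on_boundary (- r) r (- r) r z.

Lemma on_square_Cmod r z : 0 < r -> on_square r z -> r <= Cmod z.
Proof.
  intros Hr [_ Hz]. pose proof (fst_le_Cmod z). pose proof (snd_le_Cmod z).
  pose proof (Rle_abs (fst z)). pose proof (Rle_abs (- fst z)).
  pose proof (Rle_abs (snd z)). pose proof (Rle_abs (- snd z)).
  rewrite Rabs_Ropp in *. destruct Hz as [E|[E|[E|E]]]; rewrite E in *; lra.
Qed.

Lemma on_square_neq r w z : 0 < r -> Cmod w < r -> on_square r z -> z <> w.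
Proof. intros Hr Hw Hz ->. apply on_square_Cmod in Hz; auto. lra. Qed.

(** The difference quotient of [f] at [w] is differentiable off [w] and bounded
    near [w], so its integral over the boundary vanishes. *)
Theorem cauchy_square f r w : 0 < r -> Cmod w < r ->
  (forall z, in_rect (- r) r (- r) r z -> exists D, cderiv f z D) ->
  (f w * square_int (fun z => / (z - w)) r)%C = square_int (fun z => f z * / (z - w))%C r.
Proof.
  intros Hr Hw Hf.
  assert (Hw1 : - r < fst w < r).
  { pose proof (fst_le_Cmod w). destruct (Rabs_def2 (fst w) r); lra. }
  assert (Hw2 : - r < snd w < r).
  { pose proof (snd_le_Cmod w). destruct (Rabs_def2 (snd w) r); lra. }
  assert (Hbd : forall z, on_square r z -> ccont f z /\ ccont (fun z => / (z - w))%C z).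
  { intros z Hz. split.
    - destruct Hz as [Hz _]. destruct (Hf z Hz) as [D HD]. eapply cderiv_ccont; eauto.
    - eapply cderiv_ccont, cderiv_inv_shift. eapply on_square_neq; eauto. }
  destruct (Hf w) as [D HD]. { split; lra. }
  assert (H0 : rect_int (fun z => (f z - f w) * / (z - w))%C (- r) r (- r) r = 0).
  { apply (goursat_removable _ _ _ _ _ (fst w) (snd w) (1 + Cmod D)); auto;
      rewrite <- surjective_pairing.
    - intros z Hz Hzw. destruct (Hf z Hz) as [Dz HDz]. eexists.
      apply (cderiv_mult (fun z => f z - f w)%C (fun z => / (z - w))%C).
      apply (cderiv_minus f (fun _ => f w)). apply HDz. apply cderiv_const.
      now apply cderiv_inv_shift.
    - destruct (HD 1 Rlt_0_1) as [delta [Hdelta H]]. exists delta. split; auto.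
      intros z Hzw Hz. specialize (H z Hz).
      assert (Hne : (z - w)%C <> 0) by now apply Cminus_eq_contra.
      assert (Hpos : 0 < Cmod (z - w)) by now apply Cmod_gt_0.
      rewrite Cmod_mult, Cmod_inv by auto.
      apply Rmult_le_reg_r with (Cmod (z - w)); auto.
      rewrite Rmult_assoc, Rinv_l, Rmult_1_r by lra.
      replace (f z - f w)%C with ((f z - f w - D * (z - w)) + D * (z - w))%C by ring.
      rewrite Rmult_plus_distr_r. apply Cmod_triangle_le; auto.
      rewrite Cmod_mult. lra. }
  unfold square_int.
  rewrite (rect_int_ext (fun z => f z * / (z - w))%C (fun z => (f z - f w) * / (z - w) + f w * / (z - w))%C);
    try lra; [| intros z _; ring].
  rewrite (rect_int_plus (fun z => (f z - f w) * / (z - w))%C (fun z => f w * / (z - w))%C);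
    try lra.
  - rewrite H0, (rect_int_scal _ (fun z => / (z - w))%C); try lra. ring.
    intros z Hz. now apply Hbd.
  - intros z Hz. destruct (Hbd z Hz). apply ccont_mult; auto.
    apply (ccont_plus f (fun _ => (- f w)%C)); auto.
    apply (cderiv_ccont _ _ _ (cderiv_const _ _)).
  - intros z Hz. destruct (Hbd z Hz). apply ccont_mult; auto.
    apply (cderiv_ccont _ _ _ (cderiv_const _ _)).
Qed.

(** * Taylor coefficients as boundary integrals *)

Definition cauchy_coef (f : C -> C) (r : R) (n : nat) : C :=
  square_int (fun z => f z * (/ z) ^ S n)%C r.

Lemma square_int_ext f g r : 0 < r -> (forall z, on_square r z -> f z = g z) ->
  square_int f r = square_int g r.
Proof.
  intros Hr H. unfold square_int, on_square in *.
  apply rect_int_ext; [lra | lra | exact H].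
Qed.

Lemma square_int_bound f r M : 0 < r -> 0 <= M ->
  (forall z, on_square r z -> ccont f z) ->
  (forall z, on_square r z -> Cmod (f z) <= M) ->
  Cmod (square_int f r) <= 16 * M * r.
Proof.
  intros Hr HM Hc Hb. replace (16 * M * r) with (4 * M * ((r - - r) + (r - - r))) by ring.
  unfold square_int, on_square in *.
  apply (rect_int_bound f (- r) r (- r) r M); [lra | lra | exact HM | exact Hc | exact Hb].
Qed.

Lemma cauchy_coef_bound f r M n : 0 < r -> 0 <= M ->
  (forall z, on_square r z -> ccont f z /\ Cmod (f z) <= M) ->
  Cmod (cauchy_coef f r n) <= 16 * M / r ^ n.
Proof.
  intros Hr HM Hf.
  assert (Hp : 0 < r ^ n) by now apply pow_lt.
  replace (16 * M / r ^ n) with (16 * (M * (/ r) ^ S n) * r).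
  2: { simpl. rewrite pow_inv. field. lra. }
  assert (0 < / r) by now apply Rinv_0_lt_compat.
  apply square_int_bound; auto.
  - apply Rmult_le_pos; auto. apply pow_le; lra.
  - intros z Hz. destruct (Hf z Hz) as [H1 _]. pose proof (on_square_Cmod _ _ Hr Hz).
    apply (ccont_mult f (fun z => (/ z) ^ S n)%C); auto.
    apply ccont_pow, ccont_inv. apply Cmod_gt_0; lra.
  - intros z Hz. destruct (Hf z Hz) as [_ H1]. pose proof (on_square_Cmod _ _ Hr Hz).
    apply Cmod_mult_le; auto. rewrite Cmod_pow.
    apply pow_incr. split. apply Cmod_ge_0. now apply Cmod_inv_le.
Qed.

(** The identity [1 / (z - w) = 1 / z + w / (z (z - w))] under the integral. *)
Lemma cauchy_transform_step f r w : 0 < r -> Cmod w < r ->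
  (forall z, on_square r z -> ccont f z) ->
  square_int (fun z => f z * / (z - w))%C r =
  (square_int (fun z => f z * / z) r
   + w * square_int (fun z => (f z * / z) * / (z - w)) r)%C.
Proof.
  intros Hr Hw Hf. unfold square_int.
  rewrite <- rect_int_scal, <- rect_int_plus; try lra.
  - apply rect_int_ext; try lra. intros z Hz.
    pose proof (on_square_Cmod _ _ Hr Hz). pose proof (on_square_neq _ _ _ Hr Hw Hz).
    field. split. now apply Cminus_eq_contra. apply Cmod_gt_0; lra.
  - intros z Hz. pose proof (on_square_Cmod _ _ Hr Hz).
    apply (ccont_mult f Cinv); auto. apply ccont_inv. apply Cmod_gt_0; lra.
  - intros z Hz. pose proof (on_square_Cmod _ _ Hr Hz).
    apply (ccont_mult (fun _ => w)). apply ccont_const.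
    apply (ccont_mult (fun z => f z * / z)%C (fun z => / (z - w))%C).
    apply (ccont_mult f Cinv); auto. apply ccont_inv. apply Cmod_gt_0; lra.
    apply ccont_inv_shift. eapply on_square_neq; eauto.
  - intros z Hz. pose proof (on_square_Cmod _ _ Hr Hz).
    apply (ccont_mult (fun z => f z * / z)%C (fun z => / (z - w))%C).
    apply (ccont_mult f Cinv); auto. apply ccont_inv. apply Cmod_gt_0; lra.
    apply ccont_inv_shift. eapply on_square_neq; eauto.
Qed.

(** Iterating [cauchy_transform_step] on [f], [f / z], [f / z^2], and so on
    produces the expansion in Horner form; the last remainder is an integral that
    stays bounded because [w] keeps away from the boundary. *)
Lemma cauchy_transform_expands N r : 0 < r -> forall f M, 0 <= M ->
  (forall z, on_square r z -> ccont f z /\ Cmod (f z) <= M) ->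
  expands N (fun w => square_int (fun z => f z * / (z - w))%C r) (cauchy_coef f r).
Proof.
  intros Hr. induction N as [|N IH]; intros f M HM Hf.
  - exists (16 * (M * / (r / 2)) * r), (r / 2). split. lra.
    intros w _ Hw. simpl. rewrite Rmult_1_r.
    match goal with |- Cmod (?x - _) <= _ => replace (x - 0)%C with x by ring end.
    assert (Hz2 : forall z, on_square r z -> r / 2 <= Cmod (z - w)).
    { intros z Hz. apply on_square_Cmod in Hz; auto. pose proof (Cmod_minus_ge z w). lra. }
    apply square_int_bound; auto.
    + apply Rmult_le_pos; auto. left. apply Rinv_0_lt_compat. lra.
    + intros z Hz. apply (ccont_mult f (fun z => / (z - w))%C). now apply Hf.
      apply ccont_inv_shift. apply (on_square_neq r); auto. lra.
    + intros z Hz. apply Cmod_mult_le. now apply Hf.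
      apply Cmod_inv_le. lra. now apply Hz2.
  - eapply expands_cons with (delta := r) (k0 := square_int (fun z => f z * / z)%C r)
      (g := fun w => square_int (fun z => (f z * / z) * / (z - w))%C r); auto.
    + intros w _ Hw. apply cauchy_transform_step; auto. intros; now apply Hf.
    + unfold cauchy_coef. apply square_int_ext; auto. intros; simpl. ring.
    + eapply expands_ext. 2: apply (IH (fun z => f z * / z)%C (M * / r)).
      * intros n. unfold cauchy_coef. apply square_int_ext; auto. intros; simpl. ring.
      * apply Rmult_le_pos; auto. left. now apply Rinv_0_lt_compat.
      * intros z Hz. pose proof (on_square_Cmod _ _ Hr Hz). split.
        apply (ccont_mult f Cinv). now apply Hf. apply ccont_inv, Cmod_gt_0; lra.
        apply Cmod_mult_le. now apply Hf. now apply Cmod_inv_le.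
Qed.

Lemma cauchy_coef_one_S r n : 0 < r -> cauchy_coef (fun _ => 1) r (S n) = 0.
Proof.
  intros Hr. unfold cauchy_coef, square_int.
  assert (Hn : RtoC (INR (S n)) <> 0).
  { intros E. injection E as E. apply (not_0_INR (S n)); auto. }
  apply (rect_int_primitive (fun z => (- / RtoC (INR (S n))) * (/ z) ^ S n)%C); try lra.
  - intros z Hz. pose proof (on_square_Cmod _ _ Hr Hz).
    assert (z <> 0) by (apply Cmod_gt_0; lra).
    eapply cderiv_eq.
    apply (cderiv_mult (fun _ => (- / RtoC (INR (S n)))%C) (fun z => (/ z) ^ S n)%C).
    apply cderiv_const. now apply cderiv_inv_pow.
    rewrite (Cpow_S _ (S n)). field. auto.
  - intros z Hz. pose proof (on_square_Cmod _ _ Hr Hz).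
    apply (ccont_mult (fun _ => RtoC 1) (fun z => (/ z) ^ S (S n))%C). apply ccont_const.
    apply ccont_pow, ccont_inv. apply Cmod_gt_0; lra.
Qed.

(** The imaginary parts of the integrals of [dz / z] along the four edges are
    equal and positive: each is the integral of [r / (r^2 + t^2)]. *)
Lemma cauchy_coef_one_0 r : 0 < r -> cauchy_coef (fun _ => 1) r 0 <> 0.
Proof.
  intros Hr E. apply (f_equal snd) in E. revert E. apply Rgt_not_eq. unfold Rgt.
  set (J := RInt (fun t => r / (r * r + t * t)) (- r) r).
  assert (HJ : 0 < J).
  { apply RInt_gt_0; try lra.
    - intros x _. apply Rdiv_lt_0_compat; nra.
    - intros x _. apply (ex_derive_continuous (V := R_NormedModule)). auto_derive. nra. }
  replace (snd (cauchy_coef (fun _ => 1) r 0)) with (J + J + J + J).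
  { change (0 < J + J + J + J). lra. }
  assert (Hsq : forall t, r * r + t * t <> 0) by (intros t; apply Rgt_not_eq; nra).
  assert (Hsq' : forall t, t * t + r * r <> 0) by (intros t; apply Rgt_not_eq; nra).
  assert (E1 : RInt (fun t => snd (/ line (0, (- r)%R) 1 t)%C) (- r) r = J).
  { apply RInt_ext. intros t _. rewrite line_h. unfold Cinv; simpl. field; repeat split; apply Rgt_not_eq; nra. }
  assert (E2 : RInt (fun t => fst (/ line (r, 0) Ci t)%C) (- r) r = J).
  { apply RInt_ext. intros t _. rewrite line_v. unfold Cinv; simpl. field; repeat split; apply Rgt_not_eq; nra. }
  assert (E3 : - RInt (fun t => snd (/ line (0, r) 1 t)%C) (- r) r = J).
  { unfold J. rewrite <- (RInt_opp (V := R_CompleteNormedModule)).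
    - apply RInt_ext. intros t _. rewrite line_h. unfold Cinv, opp; simpl. field; repeat split; apply Rgt_not_eq; nra.
    - apply (ex_RInt_ext (fun t => - (r / (r * r + t * t)))).
      + intros t _. rewrite line_h. unfold Cinv; simpl. field; repeat split; apply Rgt_not_eq; nra.
      + apply (ex_RInt_continuous (V := R_CompleteNormedModule)). intros t _.
        apply (ex_derive_continuous (V := R_NormedModule)). auto_derive. auto. }
  assert (E4 : - RInt (fun t => fst (/ line ((- r)%R, 0) Ci t)%C) (- r) r = J).
  { unfold J. rewrite <- (RInt_opp (V := R_CompleteNormedModule)).
    - apply RInt_ext. intros t _. rewrite line_v. unfold Cinv, opp; simpl. field; repeat split; apply Rgt_not_eq; nra.
    - apply (ex_RInt_ext (fun t => - (r / (r * r + t * t)))).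
      + intros t _. rewrite line_v. unfold Cinv; simpl. field; repeat split; apply Rgt_not_eq; nra.
      + apply (ex_RInt_continuous (V := R_CompleteNormedModule)). intros t _.
        apply (ex_derive_continuous (V := R_NormedModule)). auto_derive. auto. }
  unfold cauchy_coef, square_int.
  rewrite (rect_int_ext _ Cinv) by (try lra; intros; simpl; ring).
  rewrite <- E1 at 1. rewrite <- E2 at 1. rewrite <- E3 at 1. rewrite <- E4 at 1.
  unfold rect_int, seg_int, CInt. unfold Cminus, Cmult, Cplus, Copp, RtoC, Ci.
  cbn [fst snd]. ring.
Qed.

(** With [T f w] the integral of [f z / (z - w)], Cauchy's formula gives
    [f w * T 1 w = T f w], where [T f] has the expansion [cauchy_coef f r] and
    [T 1] differs from the constant [L] by [O(w^N)] for every [N].  Multiplying the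
    latter by the bounded function [f] shows that [L * f] has the same expansion as
    [T f]. *)
Theorem holomorphic_expands f : holomorphic_near_0 f ->
  exists c r M, 0 < r <= 1 /\ 0 < M /\ (forall n, Cmod (c n) <= M / r ^ n) /\
    forall N, expands N f c.
Proof.
  intros H. apply holomorphic_disc in H. destruct H as [R0 [HR0 Hf]].
  destruct (Hf 0) as [D HD]. { rewrite Cmod_0. auto. }
  destruct (cderiv_ccont _ _ _ HD 1 Rlt_0_1) as [d [Hd Hc]].
  (* On the disc of radius [rho], [f] is differentiable, and bounded by
     [|f 0| + 1] by continuity at 0; the square of half-side [rho / 4] lies inside.
     The bound 1 on [rho] ensures [r <= 1]. *)
  set (rho := Rmin (Rmin R0 d) 1).
  assert (Hrho : 0 < rho) by (repeat apply Rmin_pos; lra).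
  pose proof (Rmin_l R0 d). pose proof (Rmin_r R0 d).
  pose proof (Rmin_l (Rmin R0 d) 1). pose proof (Rmin_r (Rmin R0 d) 1). fold rho in H1, H2.
  set (r := rho / 4).
  assert (Hr : 0 < r) by (unfold r; lra).
  assert (Hin : forall z, in_rect (- r) r (- r) r z -> Cmod z < rho).
  { intros z [Hz1 Hz2]. pose proof (Cmod_le_abs z).
    assert (Rabs (fst z) <= r) by (apply Rabs_le; lra).
    assert (Rabs (snd z) <= r) by (apply Rabs_le; lra). unfold r in *. lra. }
  set (B := Cmod (f 0) + 1).
  assert (HB : 0 < B) by (unfold B; pose proof (Cmod_ge_0 (f 0)); lra).
  assert (Hbound : forall z, Cmod z < rho -> Cmod (f z) <= B).
  { intros z Hz. specialize (Hc z). replace (z - 0)%C with z in Hc by ring.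
    specialize (Hc ltac:(lra)). pose proof (Cmod_minus_ge (f z) (f 0)). unfold B. lra. }
  assert (Hsq : forall z, on_square r z -> ccont f z /\ Cmod (f z) <= B).
  { intros z [Hz _]. apply Hin in Hz. split; auto.
    destruct (Hf z ltac:(lra)) as [Dz HDz]. eapply cderiv_ccont; eauto. }
  set (L := cauchy_coef (fun _ => 1) r 0).
  assert (HL : L <> 0) by now apply cauchy_coef_one_0.
  assert (HL0 : 0 < Cmod L) by now apply Cmod_gt_0.
  exists (fun n => / L * cauchy_coef f r n)%C, r, (/ Cmod L * (16 * B)).
  split. { unfold r; lra. }
  split. { apply Rmult_lt_0_compat. now apply Rinv_0_lt_compat. lra. }
  split.
  { intros n. unfold Rdiv. rewrite Rmult_assoc. apply Cmod_mult_le.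
    rewrite Cmod_inv by auto. lra. apply cauchy_coef_bound; auto; lra. }
  intros N.
  destruct (cauchy_transform_expands N r Hr f B ltac:(lra) Hsq) as (K1 & d1 & Hd1 & H3).
  destruct (cauchy_transform_expands N r Hr (fun _ => RtoC 1) 1 ltac:(lra)) as (K2 & d2 & Hd2 & H4).
  { intros z _. split. apply ccont_const. rewrite Cmod_1. lra. }
  assert (Hp1 : forall n z, psum (fun k => cauchy_coef (fun _ => 1) r (S k)) n z = 0).
  { intros n z.
    assert (Z : forall c : nat -> C, (forall k, c k = 0) -> psum c n z = 0).
    { induction n as [|n IH]; intros c Hc0; simpl; auto. rewrite Hc0, IH; auto. ring. }
    apply Z. intros k. now apply cauchy_coef_one_S. }
  destruct N as [|N].
  { exists B, rho. split; auto. intros z _ Hz. simpl. rewrite Rmult_1_r.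
    replace (f z - 0)%C with (f z) by ring. auto. }
  exists (/ Cmod L * (K1 + B * K2)), (Rmin r (Rmin d1 d2)).
  split. { repeat apply Rmin_pos; auto. }
  intros z Hz Hzd.
  pose proof (Rmin_l r (Rmin d1 d2)). pose proof (Rmin_r r (Rmin d1 d2)).
  pose proof (Rmin_l d1 d2). pose proof (Rmin_r d1 d2).
  specialize (H3 z Hz ltac:(lra)). specialize (H4 z Hz ltac:(lra)).
  pose proof (cauchy_square f r z Hr ltac:(lra)
    ltac:(intros u Hu; apply Hf; apply Hin in Hu; lra)) as HC.
  rewrite <- HC in H3.
  assert (E : square_int (fun u => RtoC 1 * / (u - z))%C r = square_int (fun u => / (u - z))%C r).
  { apply square_int_ext; auto. intros; ring. }
  rewrite E in H4. clear E.
  rewrite psum_scal.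
  set (T := square_int (fun u => / (u - z))%C r) in *.
  set (S1 := psum (cauchy_coef f r) (S N) z) in *.
  assert (E : psum (cauchy_coef (fun _ => 1) r) (S N) z = L).
  { simpl psum. rewrite Hp1. unfold L. ring. }
  rewrite E in H4. clear E.
  replace (f z - / L * S1)%C with (/ L * ((f z * T - S1) + - f z * (T - L)))%C
    by (field; auto).
  rewrite Rmult_assoc. apply Cmod_mult_le. rewrite Cmod_inv by auto; lra.
  rewrite Rmult_plus_distr_r. apply Cmod_triangle_le; auto.
  rewrite Rmult_assoc. apply Cmod_mult_le; auto. rewrite Cmod_opp. apply Hbound.
  unfold r in *. lra.
Qed.

(** * Power series with bounded coefficients *)

(** The series of real and imaginary parts, each a total real series that
    converges absolutely in the unit disc when [u] is bounded. *)
Definition power_series (u : nat -> C) (z : C) : C :=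
  (Series (fun n => fst (u n * z ^ n)%C), Series (fun n => snd (u n * z ^ n)%C)).

Definition bounded_by (K : R) (u : nat -> C) : Prop := forall n, Cmod (u n) <= K.

Lemma power_series_terms K u z n : bounded_by K u ->
  Rabs (fst (u n * z ^ n)%C) <= K * Cmod z ^ n /\
  Rabs (snd (u n * z ^ n)%C) <= K * Cmod z ^ n.
Proof.
  intros Hu.
  assert (H : Cmod (u n * z ^ n) <= K * Cmod z ^ n).
  { apply Cmod_mult_le; auto. rewrite Cmod_pow. lra. }
  split; (eapply Rle_trans; [|apply H]); [apply fst_le_Cmod | apply snd_le_Cmod].
Qed.

Lemma ex_series_majorant (K q : R) : 0 <= q < 1 -> ex_series (fun n => K * q ^ n).
Proof.
  intros Hq. apply (ex_series_scal_l (V := R_NormedModule) K).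
  apply ex_series_geom. rewrite Rabs_pos_eq; lra.
Qed.

Lemma ex_power_series K u z : bounded_by K u -> Cmod z < 1 ->
  ex_series (fun n => fst (u n * z ^ n)%C) /\ ex_series (fun n => snd (u n * z ^ n)%C).
Proof.
  intros Hu Hz. pose proof (Cmod_ge_0 z).
  split; apply (ex_series_le (V := R_CompleteNormedModule)) with (fun n => K * Cmod z ^ n);
    try (apply ex_series_majorant; lra); intros n; now apply power_series_terms.
Qed.

Lemma power_series_bound K u z : bounded_by K u -> Cmod z < 1 ->
  Cmod (power_series u z) <= 2 * K / (1 - Cmod z).
Proof.
  intros Hu Hz. pose proof (Cmod_ge_0 z).
  assert (Hs : forall a : nat -> R, (forall n, Rabs (a n) <= K * Cmod z ^ n) ->
    Rabs (Series a) <= K / (1 - Cmod z)).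
  { intros a Ha. pose proof (ex_series_majorant K (Cmod z) ltac:(lra)) as Hm.
    eapply Rle_trans. apply Series_Rabs.
    - apply (ex_series_le (V := R_CompleteNormedModule)) with (fun n => K * Cmod z ^ n); auto.
      intros n. unfold norm; simpl. unfold abs; simpl. rewrite Rabs_Rabsolu. auto.
    - eapply Rle_trans. apply (Series_le _ (fun n => K * Cmod z ^ n)); auto.
      intros n; split; auto using Rabs_pos.
      rewrite Series_scal_l, Series_geom by (rewrite Rabs_pos_eq; lra).
      right. unfold Rdiv. reflexivity. }
  eapply Rle_trans. apply Cmod_le_abs. unfold power_series; simpl.
  replace (2 * K / (1 - Cmod z)) with (K / (1 - Cmod z) + K / (1 - Cmod z)) by (field; lra).
  apply Rplus_le_compat; apply Hs; intros n; now apply power_series_terms.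
Qed.

Lemma power_series_cons K u z : bounded_by K u -> Cmod z < 1 ->
  power_series u z = (u O + z * power_series (fun n => u (S n)) z)%C.
Proof.
  intros Hu Hz.
  destruct (ex_power_series K u z Hu Hz) as [E1 E2].
  destruct (ex_power_series K (fun n => u (S n)) z (fun n => Hu (S n)) Hz) as [F1 F2].
  unfold power_series. unfold Cmult at 3. unfold Cplus. cbn [fst snd].
  apply injective_projections; cbn [fst snd].
  - rewrite Series_incr_1 by auto. f_equal. simpl; ring.
    rewrite <- !Series_scal_l, <- Series_minus.
    + apply Series_ext. intros n. simpl. ring.
    + apply (ex_series_scal_l (V := R_NormedModule) (fst z) _ F1).
    + apply (ex_series_scal_l (V := R_NormedModule) (snd z) _ F2).
  - rewrite Series_incr_1 by auto. f_equal. simpl; ring.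
    rewrite <- !Series_scal_l, <- Series_plus.
    + apply Series_ext. intros n. simpl. ring.
    + apply (ex_series_scal_l (V := R_NormedModule) (fst z) _ F2).
    + apply (ex_series_scal_l (V := R_NormedModule) (snd z) _ F1).
Qed.

Lemma power_series_minus K u v z : bounded_by K u -> bounded_by K v -> Cmod z < 1 ->
  power_series (fun n => u n - v n)%C z = (power_series u z - power_series v z)%C.
Proof.
  intros Hu Hv Hz.
  destruct (ex_power_series K u z Hu Hz) as [E1 E2].
  destruct (ex_power_series K v z Hv Hz) as [F1 F2].
  unfold power_series, Cminus, Cplus, Copp. apply injective_projections; cbn [fst snd];
    symmetry; etransitivity.
  - symmetry. apply (Series_minus _ _ E1 F1).
  - apply Series_ext. intros n. simpl. ring.
  - symmetry. apply (Series_minus _ _ E2 F2).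
  - apply Series_ext. intros n. simpl. ring.
Qed.

Lemma power_series_scal K k u z : bounded_by K u -> Cmod z < 1 ->
  power_series (fun n => k * u n)%C z = (k * power_series u z)%C.
Proof.
  intros Hu Hz.
  destruct (ex_power_series K u z Hu Hz) as [E1 E2].
  unfold power_series. unfold Cmult at 5. cbn [fst snd].
  rewrite <- !Series_scal_l.
  rewrite <- Series_minus, <- Series_plus;
    try (apply (ex_series_scal_l (V := R_NormedModule)); assumption).
  f_equal; apply Series_ext; intros n; simpl; ring.
Qed.

(** Splitting off the constant term repeatedly leaves [z^N] times a power series
    with the same bound on its coefficients. *)
Lemma power_series_expands N u K : bounded_by K u -> expands N (power_series u) u.
Proof.
  revert u. induction N as [|N IH]; intros u Hu.
  - exists (2 * K / (1 / 2)), (1 / 2). split. lra. intros z _ Hz. simpl.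
    rewrite Rmult_1_r. replace (power_series u z - 0)%C with (power_series u z) by ring.
    assert (0 <= K) by (eapply Rle_trans; [apply Cmod_ge_0 | apply (Hu O)]).
    eapply Rle_trans. apply power_series_bound with (K := K); auto. lra.
    unfold Rdiv. apply Rmult_le_compat_l. lra. apply Rinv_le_contravar; lra.
  - apply (expands_cons N _ (power_series (fun n => u (S n))) u (u O) 1 Rlt_0_1); auto.
    + intros z _ Hz. now apply power_series_cons with K.
    + apply IH. intros n. apply Hu.
Qed.

(** For each [k], the value at [w] of the series [sum_j u_{k+j} w^j].  As a sequence
    in [k] it is bounded, so it is the coefficient sequence of a power series. *)
Definition tails (u : nat -> C) (w : C) (k : nat) : C :=
  power_series (fun n => u (k + n)%nat) w.

Lemma tails_bounded K u w : bounded_by K u -> Cmod w < 1 / 2 ->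
  bounded_by (4 * K) (tails u w).
Proof.
  intros Hu Hw k.
  assert (0 <= K) by (eapply Rle_trans; [apply Cmod_ge_0 | apply (Hu O)]).
  eapply Rle_trans. apply power_series_bound with (K := K). intros n; apply Hu. lra.
  replace (4 * K) with (2 * K * / (1 / 2)) by field.
  unfold Rdiv. apply Rmult_le_compat_l. lra. apply Rinv_le_contravar; lra.
Qed.

Lemma tails_cons K u w k : bounded_by K u -> Cmod w < 1 ->
  tails u w k = (u k + w * tails u w (S k))%C.
Proof.
  intros Hu Hw. unfold tails.
  rewrite (power_series_cons K) by (auto; intros n; apply Hu).
  replace (k + 0)%nat with k by lia. do 2 f_equal. f_equal.
  apply functional_extensionality. intros n. f_equal. lia.
Qed.

(** The difference quotient of [sum_n u_n z^n] between [z] and [w] is itself a power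
    series in [z], with the tails at [w] as coefficients.  Indeed
    [u_k = T_k - w T_{k+1}] for the tails [T_k] at [w]; summing against [z^k] gives
    [u(z) = T_0 + (z - w) sum_k T_{k+1} z^k], and [T_0 = u(w)]. *)
Lemma power_series_slope K u w z : bounded_by K u -> Cmod w < 1 / 2 -> Cmod z < 1 / 2 ->
  (power_series u w - power_series u z)%C =
  ((w - z) * power_series (fun k => tails u w (S k)) z)%C.
Proof.
  intros Hu Hw Hz.
  pose proof (tails_bounded K u w Hu Hw) as HT.
  assert (HS : bounded_by (4 * K) (fun k => tails u w (S k))) by (intros k; apply HT).
  assert (HwS : bounded_by (4 * K) (fun k => w * tails u w (S k))%C).
  { intros k. replace (4 * K) with (1 * (4 * K)) by ring. apply Cmod_mult_le. lra. apply HT. }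
  assert (E : power_series u z = power_series (fun k => tails u w k - w * tails u w (S k))%C z).
  { f_equal. apply functional_extensionality. intros k.
    rewrite (tails_cons K u w k) by (auto; lra). ring. }
  rewrite E.
  rewrite (power_series_minus (4 * K)) by (auto; lra).
  rewrite (power_series_scal (4 * K) w) by (auto; lra).
  rewrite (power_series_cons (4 * K) (tails u w)) by (auto; lra).
  replace (tails u w 0) with (power_series u w) by reflexivity. ring.
Qed.

Lemma power_series_lipschitz K u w z : bounded_by K u -> Cmod w < 1 / 2 -> Cmod z < 1 / 2 ->
  Cmod (power_series u w - power_series u z) <= 16 * K * Cmod (w - z).
Proof.
  intros Hu Hw Hz. rewrite (power_series_slope K) by auto.
  rewrite Rmult_comm. apply Cmod_mult_le. lra.
  assert (0 <= K) by (eapply Rle_trans; [apply Cmod_ge_0 | apply (Hu O)]).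
  eapply Rle_trans. apply power_series_bound with (K := 4 * K). 2: lra.
  intros k. now apply tails_bounded.
  replace (16 * K) with (2 * (4 * K) * / (1 / 2)) by field.
  unfold Rdiv. apply Rmult_le_compat_l. lra. apply Rinv_le_contravar; lra.
Qed.

(** By [power_series_slope] the difference quotient is a power series whose
    coefficients, the tails at [w], are Lipschitz in [w]; so it converges to its
    value at [w = z], at a linear rate. *)
Lemma power_series_cderiv K u z : bounded_by K u -> Cmod z < 1 / 2 ->
  cderiv (power_series u) z (power_series (fun k => tails u z (S k)) z).
Proof.
  intros Hu Hz eps He.
  assert (HK : 0 <= K) by (eapply Rle_trans; [apply Cmod_ge_0 | apply (Hu O)]).
  (* The tails are Lipschitz with constant [16 K], and summing a series in the
     disc of radius 1/2 costs another factor 4. *)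
  set (B := 64 * K + 1). assert (HB : 0 < B) by (unfold B; lra).
  exists (Rmin (1 / 2 - Cmod z) (eps / B)). split.
  { apply Rmin_pos. lra. now apply Rdiv_lt_0_compat. }
  intros w Hwz. pose proof (Rmin_l (1 / 2 - Cmod z) (eps / B)).
  pose proof (Rmin_r (1 / 2 - Cmod z) (eps / B)).
  assert (Hw : Cmod w < 1 / 2).
  { replace w with ((w - z) + z)%C by ring. pose proof (Cmod_triangle (w - z) z). lra. }
  rewrite (power_series_slope K u w z) by auto.
  set (V := fun k => tails u w (S k)). set (V' := fun k => tails u z (S k)).
  replace ((w - z) * power_series V z - power_series V' z * (w - z))%C
    with ((power_series V z - power_series V' z) * (w - z))%C by ring.
  apply Cmod_mult_le; [|lra].
  assert (HV : bounded_by (4 * K) V) by (intros k; now apply tails_bounded).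
  assert (HV' : bounded_by (4 * K) V') by (intros k; now apply tails_bounded).
  rewrite <- (power_series_minus (4 * K) V V' z HV HV') by lra.
  assert (HD : bounded_by (16 * K * Cmod (w - z)) (fun k => V k - V' k)%C).
  { intros k. apply power_series_lipschitz; [intros n; apply Hu | assumption | assumption]. }
  assert (HD0 : 0 <= 16 * K * Cmod (w - z)).
  { apply Rmult_le_pos. lra. apply Cmod_ge_0. }
  eapply Rle_trans. apply power_series_bound with (1 := HD). lra.
  apply Rle_trans with (2 * (16 * K * Cmod (w - z)) * / (1 / 2)).
  { unfold Rdiv. apply Rmult_le_compat_l. lra. apply Rinv_le_contravar; lra. }
  apply Rle_trans with (B * Cmod (w - z)).
  { unfold B. pose proof (Cmod_ge_0 (w - z)). lra. }
  apply Rle_trans with (B * (eps / B)). apply Rmult_le_compat_l; lra.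
  right. field. lra.
Qed.

Lemma power_series_holomorphic K u : bounded_by K u -> holomorphic_near_0 (power_series u).
Proof.
  intros Hu. apply holomorphic_disc. exists (1 / 2). split. lra.
  intros z Hz. eexists. now apply power_series_cderiv with K.
Qed.

Lemma power_series_0 K u : bounded_by K u -> power_series u 0 = u O.
Proof.
  intros Hu. rewrite (power_series_cons K); auto. ring. rewrite Cmod_0. lra.
Qed.

(** * Small divisors *)

Lemma cis_pow t n : (cis t ^ n)%C = cis (INR n * t).
Proof.
  induction n as [|n IH].
  - simpl. rewrite Rmult_0_l. unfold cis. now rewrite cos_0, sin_0.
  - rewrite Cpow_S, IH, S_INR. unfold cis, Cmult; simpl.
    replace ((INR n + 1) * t) with (t + INR n * t) by ring.
    rewrite cos_plus, sin_plus. f_equal; ring.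
Qed.

Lemma Cmod_cis t : Cmod (cis t) = 1.
Proof.
  unfold cis, Cmod; cbn [fst snd]. replace (cos t ^ 2 + sin t ^ 2) with 1.
  apply sqrt_1. pose proof (sin2_cos2 t). unfold Rsqr in *. lra.
Qed.

(** If [cos (2 n theta pi) = 1] then [sin (n theta pi) = 0], so [n theta] is an
    integer and [theta] is rational. *)
Lemma irrational_pow_neq_1 theta n : irrational theta -> (0 < n)%nat ->
  (cis (2 * PI * theta) ^ n)%C <> 1.
Proof.
  intros Hirr Hn E. rewrite cis_pow in E. apply (f_equal fst) in E.
  unfold cis in E; cbn [fst RtoC] in E.
  replace (INR n * (2 * PI * theta)) with (2 * (INR n * theta * PI)) in E by ring.
  rewrite cos_2a_sin in E.
  assert (Hs : sin (INR n * theta * PI) = 0) by nra.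
  apply sin_eq_0_0 in Hs. destruct Hs as [k Hk].
  assert (HPI := PI_RGT_0).
  assert (Hn' : 0 < INR n) by (apply lt_0_INR; lia).
  assert (Hk' : INR n * theta = IZR k) by nra.
  apply (Hirr (k # Pos.of_nat n)). unfold Q2R; simpl.
  rewrite <- Hk', INR_IZR_INZ.
  replace (Z.pos (Pos.of_nat n)) with (Z.of_nat n) by lia.
  rewrite INR_IZR_INZ in Hn'. field. lra.
Qed.

Lemma MinRlist_ge b l : b <= 1 -> (forall x, In x l -> b <= x) -> b <= MinRlist l.
Proof.
  intros Hb. induction l as [|x l IH]; intros H; simpl; auto.
  destruct l as [|y l]. { apply H; now left. }
  apply Rmin_glb. apply H; now left. apply IH. intros; apply H; now right.
Qed.

(** A geometric lower bound [r^n / M] on [|lambda^n - 1|] passes to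
    [|lambda^k - lambda| = |lambda^(k-1) - 1|] and to their minimum [omega lambda m],
    so that [ln (1 / omega lambda m) <= ln M + m ln (1 / r)].  Divided by [m] this is
    bounded, and the upper limit cannot be infinite. *)
Lemma Cremer_divisors lambda : Cremer lambda ->
  forall r M, 0 < r <= 1 -> 1 <= M ->
  ~ (forall n, (0 < n)%nat -> r ^ n <= M * Cmod (lambda ^ n - 1)).
Proof.
  intros [(theta & _ & ->) HL] r M Hr HM Hd.
  set (lambda := cis (2 * PI * theta)) in *.
  assert (Hom : forall m, r ^ m / M <= omega lambda m).
  { intros m. assert (Hrm : 0 < r ^ m) by (apply pow_lt; lra).
    unfold omega. apply MinRlist_ge.
    - apply Rmult_le_reg_r with M; [lra|]. unfold Rdiv.
      rewrite Rmult_assoc, Rinv_l by lra.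
      assert (r ^ m <= 1 ^ m) by (apply pow_incr; lra). rewrite pow1 in H. lra.
    - intros x Hx. apply in_map_iff in Hx. destruct Hx as [k [<- Hk]].
      apply in_seq in Hk. destruct k as [|k]; [lia|].
      rewrite Cpow_S. replace (lambda * lambda ^ k - lambda)%C
        with (lambda * (lambda ^ k - 1))%C by ring.
      rewrite Cmod_mult. unfold lambda at 1. rewrite Cmod_cis, Rmult_1_l.
      specialize (Hd k ltac:(lia)).
      assert (r ^ m <= r ^ k).
      { replace m with (k + (m - k))%nat by lia. rewrite pow_add.
        assert (0 < r ^ k) by (apply pow_lt; lra).
        assert (r ^ (m - k) <= 1 ^ (m - k)) by (apply pow_incr; lra).
        rewrite pow1 in H0. nra. }
      apply Rmult_le_reg_l with M; [lra|].
      replace (M * (r ^ m / M)) with (r ^ m) by (field; lra). lra. }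
  set (B := ln M + ln (/ r)).
  assert (Hle : Rbar_le (LimSup_seq (fun m => 1 / INR m * ln (1 / omega lambda m)))
                        (LimSup_seq (fun _ => B))).
  { apply LimSup_le. exists 1%nat. intros m Hm.
    assert (Hrm : 0 < r ^ m) by (apply pow_lt; lra).
    specialize (Hom m).
    assert (H0 : 0 < r ^ m / M) by (apply Rdiv_lt_0_compat; lra).
    assert (Hln : ln (1 / omega lambda m) <= ln (M * (/ r) ^ m)).
    { apply ln_le. apply Rdiv_lt_0_compat; lra.
      replace (M * (/ r) ^ m) with (/ (r ^ m / M)).
      unfold Rdiv at 1. rewrite Rmult_1_l. apply Rinv_le_contravar; lra.
      rewrite pow_inv. field. lra. }
    assert (Hir : 0 < / r) by (apply Rinv_0_lt_compat; lra).
    rewrite ln_mult in Hln; try lra. 2: now apply pow_lt.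
    rewrite ln_pow in Hln by auto.
    assert (HlnM : 0 <= ln M) by (rewrite <- ln_1; apply ln_le; lra).
    assert (Hm1 : 1 <= INR m) by (apply (le_INR 1); lia).
    unfold B. apply Rmult_le_reg_l with (INR m); [lra|].
    replace (INR m * (1 / INR m * ln (1 / omega lambda m)))
      with (ln (1 / omega lambda m)) by (field; lra).
    nra. }
  rewrite HL, LimSup_seq_const in Hle. exact Hle.
Qed.

(** * The recursive choice of the coefficients *)

(** Definition by course-of-values recursion.  The earlier values are passed as a
    sequence cut off to 0 from index [n] on. *)
Lemma strong_recursion (G : nat -> (nat -> C) -> C) :
  exists c, forall n, c n = G n (fun m => if Nat.ltb m n then c m else RtoC 0).
Proof.
  (* [tbl n] holds the first [n] values, followed by zeros. *)
  set (tbl := fix tbl n := match n with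
    | O => fun _ : nat => RtoC 0
    | S n => fun m => if Nat.ltb m n then tbl n m
                      else if Nat.eqb m n then G n (tbl n) else RtoC 0 end).
  exists (fun n => G n (tbl n)).
  intros n. f_equal. apply functional_extensionality. intros m.
  induction n as [|n IH]; simpl; auto.
  destruct (Nat.ltb_spec m n); destruct (Nat.ltb_spec m (S n)); try lia; auto.
  - rewrite Nat.eqb_sym. destruct (Nat.eqb_spec n m); [subst; auto | lia].
  - destruct (Nat.eqb_spec m n); auto; lia.
Qed.

Definition nudge (s : C) : C := if Rle_dec (1 / 2) (Cmod s) then RtoC 0 else RtoC 1.

Lemma nudge_bound s : Cmod (nudge s) <= 1.
Proof. unfold nudge. destruct Rle_dec; rewrite ?Cmod_0, ?Cmod_1; lra. Qed.

(** Either [s] itself or, by the triangle inequality, [1 + s] has modulus at least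
    1/2. *)
Lemma nudge_far s : 1 / 2 <= Cmod (nudge s + s).
Proof.
  unfold nudge. destruct Rle_dec as [H|H].
  - now rewrite Cplus_0_l.
  - pose proof (Cmod_minus_ge 1 (- s)) as K. rewrite Cmod_1, Cmod_opp in K.
    replace (1 - - s)%C with (1 + s)%C in K by ring. lra.
Qed.

(** The coefficients [a_n] and [c_n] are chosen together: [c_n] solves the
    coefficient equation for [a_n = nudge (conv c c n)], and this is a recursion since
    [c_0 = 0] removes [c_n] from [conv c c n]. *)
Lemma formal_solution (lambda : C) :
  (forall n, (0 < n)%nat -> (lambda ^ n)%C <> 1) ->
  exists a c : nat -> C,
    a O = 0 /\ c O = 0 /\ bounded_by 1 a /\
    (forall n, (0 < n)%nat -> ((lambda ^ n - 1) * c n = a n + conv c c n)%C) /\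
    (forall n, (0 < n)%nat -> 1 / 2 <= Cmod (lambda ^ n - 1) * Cmod (c n)).
Proof.
  intros Hl.
  destruct (strong_recursion (fun n t => match n with O => RtoC 0 | _ =>
    (nudge (conv t t n) + conv t t n) / (lambda ^ n - 1) end)%C) as [c Hc].
  assert (Hc0 : c O = 0) by apply Hc.
  assert (Hcn : forall n, (0 < n)%nat ->
    ((lambda ^ n - 1) * c n = nudge (conv c c n) + conv c c n)%C).
  { intros n Hn.
    (* Cutting [c] off from index [n] on changes only the two extreme terms of the
       convolution, and these contain the factor [c_0 = 0]. *)
    assert (E : conv (fun m => if Nat.ltb m n then c m else RtoC 0)
        (fun m => if Nat.ltb m n then c m else RtoC 0) n = conv c c n).
    { unfold conv. apply sum_n_ext_loc. intros k Hk.
      destruct (Nat.ltb_spec k n), (Nat.ltb_spec (n - k) n); auto.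
      - replace k with O by lia. now rewrite Hc0, !Cmult_0_l.
      - replace (n - k)%nat with O by lia. now rewrite Hc0, !Cmult_0_r.
      - lia. }
    rewrite (Hc n). rewrite E. destruct n as [|n]; [lia|].
    field. apply Cminus_eq_contra. auto. }
  exists (fun n => match n with O => RtoC 0 | _ => nudge (conv c c n) end), c.
  repeat split; auto.
  - intros [|n]. rewrite Cmod_0; lra. apply nudge_bound.
  - intros [|n] Hn; [lia|]. now apply Hcn.
  - intros n Hn. rewrite <- Cmod_mult, Hcn by auto. apply nudge_far.
Qed.

Lemma conv_self_ext (c d : nat -> C) n : c O = 0 -> d O = 0 ->
  (forall k, (k < n)%nat -> c k = d k) -> conv c c n = conv d d n.
Proof.
  intros Hc Hd H. unfold conv. apply sum_n_ext_loc. intros k Hk.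
  destruct (Nat.eq_dec k 0) as [->|Hk0]. { now rewrite Hc, Hd, !Cmult_0_l. }
  destruct (Nat.eq_dec k n) as [->|Hkn].
  { now rewrite Nat.sub_diag, Hc, Hd, !Cmult_0_r. }
  rewrite !H by lia. reflexivity.
Qed.

Theorem proposition9 (lambda : C) (hlambda : Cremer lambda) :
  exists a : C -> C,
    holomorphic_near_0 a /\ a (RtoC 0) = RtoC 0 /\
    ~ (exists phi : C -> C,
         holomorphic_near_0 phi /\ invariant_curve (skew_product lambda a) phi).
Proof.
  assert (Hl : forall n, (0 < n)%nat -> (lambda ^ n)%C <> 1).
  { destruct hlambda as [(theta & Hirr & ->) _]. intros n Hn. now apply irrational_pow_neq_1. }
  assert (Hl1 : Cmod lambda = 1).
  { destruct hlambda as [(theta & Hirr & ->) _]. apply Cmod_cis. }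
  destruct (formal_solution lambda Hl) as (a & c & Ha0 & Hc0 & Ha & Hrec & Hbig).
  exists (power_series a). split. { now apply power_series_holomorphic with 1. }
  split. { now rewrite (power_series_0 1). }
  intros (phi & Hphi & Hinv).
  destruct (holomorphic_expands phi Hphi) as (g & r & M & Hr & HM & Hg & Hexp).
  rewrite invariant_curve_skew_product, locally_disc in Hinv.
  destruct Hinv as [rho [Hrho Hinv]].
  assert (Hcoef : forall n, (lambda ^ n * g n = g n + a n + conv g g n)%C).
  { apply (expands_unique (fun z => phi (lambda * z)%C)).
    - intros N. now apply expands_rot.
    - intros N. apply (expands_near N (fun z => phi z + power_series a z + phi z * phi z)%C
        _ _ rho Hrho).
      + intros z Hz. rewrite <- Hinv by auto. ring.
      + apply (expands_plus N (fun z => phi z + power_series a z)%C (fun z => phi z * phi z)%C).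
        * apply expands_plus; auto. now apply power_series_expands with 1.
        * now apply expands_mult. }
  (* The constant terms satisfy [g_0 = g_0 + g_0^2]. *)
  assert (Hg0 : g O = 0).
  { specialize (Hcoef O). rewrite conv_0, Ha0 in Hcoef. simpl in Hcoef.
    destruct (classic (g O = 0)) as [|Hne]; auto. exfalso.
    apply (Cmult_neq_0 _ _ Hne Hne).
    replace (g O * g O)%C with ((g O + 0 + g O * g O) - 1 * g O)%C by ring.
    rewrite <- Hcoef. ring. }
  (* The coefficient equations determine the solution, as [lambda^n <> 1]. *)
  assert (Hgc : forall n, g n = c n).
  { induction n as [n IH] using (well_founded_induction Wf_nat.lt_wf).
    destruct n as [|n]; [congruence|].
    assert (Hne : (lambda ^ S n - 1)%C <> 0) by (apply Cminus_eq_contra, Hl; lia).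
    assert (E : ((lambda ^ S n - 1) * g (S n) = (lambda ^ S n - 1) * c (S n))%C).
    { rewrite Hrec by lia. rewrite <- (conv_self_ext g c) by (auto; intros; apply IH; lia).
      replace ((lambda ^ S n - 1) * g (S n))%C with (lambda ^ S n * g (S n) - g (S n))%C by ring.
      rewrite Hcoef. ring. }
    apply (f_equal (Cmult (/ (lambda ^ S n - 1)))) in E.
    rewrite !Cmult_assoc, Cinv_l, !Cmult_1_l in E by auto. exact E. }
  apply (Cremer_divisors lambda hlambda r (2 * M + 1) Hr); [lra|].
  intros n Hn. specialize (Hbig n Hn). rewrite <- Hgc in Hbig.
  assert (Hrn : 0 < r ^ n) by (apply pow_lt; lra).
  specialize (Hg n). pose proof (Cmod_ge_0 (lambda ^ n - 1)) as Hp.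
  assert (K : 1 / 2 <= Cmod (lambda ^ n - 1) * (M / r ^ n)).
  { eapply Rle_trans. apply Hbig. now apply Rmult_le_compat_l. }
  apply Rmult_le_compat_r with (r := r ^ n) in K; [|lra].
  replace (Cmod (lambda ^ n - 1) * (M / r ^ n) * r ^ n)
    with (Cmod (lambda ^ n - 1) * M) in K by (field; lra).
  lra.
Qed.
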